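(* Let $\mu,\nu\in\mathcal{M}^{\infty}(G)$ and let $\mathcal{A}=(A_n)_{n\in\mathbb N}$ be a van Hove sequence in $G$ such that the Eberlein convolution $\mu\circledast_{\mathcal A}\nu$ exists. If $\mu$ is norm almost periodic, then $\mu\circledast_{\mathcal A}\nu$ is norm almost periodic.
   Context: $G$ is a second countable, locally compact (Hausdorff) Abelian group with Haar measure $|\cdot|$. A van Hove sequence is a sequence $\mathcal A=(A_n)_{n\in\mathbb N}$ of precompact open subsets of $G$ (of positive measure) such that $\lim_{n}|\partial^K A_n|/|A_n|=0$ for each compact $K\subseteq G$, where for open $A$, $\partial^K A:=(\overline{A+K}\setminus A)\cup(((G\setminus A)-K)\cap\overline A)$. A measure on $G$ is a complex Radon measure, viewed as a linear functional on $C_c(G)$; $|\mu|$ denotes its variation measure. For a compact $K\subseteq G$ with non-empty interior let $\|\mu\|_K:=\sup_{t\in G}|\mu|(t+K)$. $\mathcal M^\infty(G)$ is the set of translation bounded measures, i.e. those with $\|\mu\|_K<\infty$ for every such $K$. The Eberlein convolution is $\mu\circledast_{\mathcal A}\nu:=\lim_{n\to\infty}\frac1{|A_n|}(\mu|_{A_n})*(\nu|_{-A_n})$, said to exist if this limit exists in the vague topology. With $(\tau_tg)(x)=g(x-t)$ and $(\tau_t\mu)(g)=\mu(\tau_{-t}g)$, a measure $\mu$ is norm almost periodic if, for a fixed compact $K\subseteq G$ with non-empty interior (the notion does not depend on $K$ for translation bounded measures) and all $\varepsilon>0$, the set $\{t\in G:\|\mu-\tau_t\mu\|_K<\varepsilon\}$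 is relatively dense in $G$. *)

(* Defs.v *)
From HB Require Import structures.
From mathcomp Require Import all_boot all_order all_algebra.
From mathcomp Require Import complex.
From mathcomp Require Import all_classical all_reals all_analysis.

Set Implicit Arguments.
Unset Strict Implicit.
Unset Printing Implicit Defensive.

Import Order.TTheory GRing.Theory Num.Theory.
Import numFieldNormedType.Exports.

Local Open Scope classical_set_scope.
Local Open Scope ring_scope.

(* The alias [^o] is what gives the complex numbers their usual topology. *)
Local Notation "'Cplx' R" := ((R[i])^o)%type (at level 10, only parsing).

Definition modulus (R : realType) (z : Cplx R) : R :=
  ComplexField.Normc.normc (z : R[i]).

Section Sets.
Context {G : topologicalZmodType}.

Definition shift_set (t : G) (K : set G) : set G := [set t + x | x in K].

Definition opp_set (A : set G) : set G := [set - a | a in A].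

Definition add_set (A B : set G) : set G := [set a + b | a in A & b in B].

Definition relatively_dense (S : set G) : Prop :=
  exists2 K : set G, compact K & add_set S K = setT.

Definition van_Hove_boundary (K A : set G) : set G :=
  (closure (add_set A K) `\` A)
  `|` (add_set (~` A) (opp_set K) `&` closure A).

End Sets.

(* The Borel measurable space of G: a measurableType has to be pointed, and a
   topologicalZmodType is not one by itself. *)
Definition pointed_carrier (G : topologicalZmodType) : Type := G.
HB.instance Definition _ (G : topologicalZmodType) :=
  Choice.copy (pointed_carrier G) G.
HB.instance Definition _ (G : topologicalZmodType) :=
  isPointed.Build (pointed_carrier G) (0 : G).

Definition borelType (G : topologicalZmodType) :=
  g_sigma_algebraType (@open G : set (set (pointed_carrier G))).

Section HaarMeasure.
Context {R : realType} {G : topologicalZmodType}.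
Implicit Type haar : {measure set (borelType G) -> \bar R}.

(* On a second countable locally compact group a Borel measure which is finite
   on compact sets is automatically regular. *)
Definition is_Haar haar : Prop :=
  [/\ forall K : set G, compact K -> (haar K < +oo)%E,
      forall (t : G) (B : set (borelType G)), measurable B ->
        haar (shift_set t B) = haar B
    & haar setT != 0%E].

Definition van_Hove haar (A : nat -> set G) : Prop :=
  [/\ forall n, open (A n),
      forall n, precompact (A n),
      forall n, (0 < haar (A n))%E
    & forall K : set G, compact K ->
        (fun n => fine (haar (van_Hove_boundary K (A n)))
                  / fine (haar (A n))) @ \oo --> (0 : R)].

End HaarMeasure.

Definition Cc {G : topologicalZmodType} {V : topologicalZmodType}
    (f : G -> V) : Prop :=
  continuous f /\ compact (closure [set x | f x != 0]).

(* Measures are functionals on C_c(G); they are represented by functions defined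
   on all of G -> C, whose values outside C_c(G) are irrelevant. *)
Definition functional (R : realType) (G : topologicalZmodType) : Type :=
  (G -> Cplx R) -> Cplx R.

Section Measures.
Context {R : realType} {G : topologicalZmodType}.
Implicit Types (mu nu sigma : functional R G) (A B K : set G) (t : G).

Definition Radon_measure mu : Prop :=
  [/\ forall f g : G -> Cplx R, Cc f -> Cc g ->
        mu (fun x => f x + g x) = mu f + mu g,
      forall (c : Cplx R) (f : G -> Cplx R), Cc f ->
        mu (fun x => c * f x) = c * mu f
    & forall K, compact K -> exists M : R,
        forall (f : G -> Cplx R) (b : R), Cc f ->
          (forall x, ~ K x -> f x = 0) -> (forall x, modulus (f x) <= b) ->
          modulus (mu f) <= M * b].

(* The value |mu|(f) of the variation measure, for 0 <= f in C_c(G). *)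
Definition variation_fun mu (f : G -> R) : \bar R :=
  ereal_sup [set (modulus (mu g))%:E |
    g in [set g : G -> Cplx R | Cc g /\ forall x, modulus (g x) <= f x]].

(* Bourbaki's upper integral with respect to |mu| of a function h >= 0, first
   for lower semicontinuous h, then for arbitrary h. *)
Definition upper_integral_lsc mu (h : G -> \bar R) : \bar R :=
  ereal_sup [set variation_fun mu f |
    f in [set f : G -> R |
            Cc f /\ forall x, 0 <= f x /\ ((f x)%:E <= h x)%E]].

Definition upper_integral mu (h : G -> \bar R) : \bar R :=
  ereal_inf [set upper_integral_lsc mu k |
    k in [set k : G -> \bar R |
            lower_semicontinuous k /\ forall x, (h x <= k x)%E]].

(* |mu|(B); this is the outer measure, which agrees with |mu| on Borel sets. *)
Definition variation_set mu B : \bar R :=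
  upper_integral mu (fun x => (\1_B x)%:E).

Definition norm_on K mu : \bar R :=
  ereal_sup [set variation_set mu (shift_set t K) | t in setT].

Definition translation_bounded mu : Prop :=
  forall K, compact K -> interior K !=set0 -> (norm_on K mu < +oo)%E.

(* f is mu-integrable with integral z: L^1(|mu|) is the closure of C_c(G) for
   the seminorm given by the upper integral of the modulus, and the integral is
   the continuous extension of mu. *)
Definition is_integral mu (f : G -> Cplx R) (z : Cplx R) : Prop :=
  forall eps : R, 0 < eps -> exists g : G -> Cplx R,
    [/\ Cc g,
        (upper_integral mu (fun x => (modulus (f x - g x))%:E) <= eps%:E)%E
      & modulus (z - mu g) <= eps].

Definition integral_against mu (f : G -> Cplx R) : Cplx R :=
  xget 0 [set z | is_integral mu f z].

Definition restrict_measure mu A : functional R G :=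
  fun f => integral_against mu (fun x => if x \in A then f x else 0).

(* (mu * nu)(f) is the double integral of f(x + y); for nu of compact support,
   the inner integral is a function of class C_c of x. *)
Definition convolution mu nu : functional R G :=
  fun f => mu (fun x => nu (fun y => f (x + y))).

Definition translate_fun t (g : G -> Cplx R) : G -> Cplx R :=
  fun x => g (x - t).

Definition translate_measure t mu : functional R G :=
  fun g => mu (translate_fun (- t) g).

Definition vague_cvg (mus : nat -> functional R G) mu : Prop :=
  forall f : G -> Cplx R, Cc f -> (fun n => mus n f) @ \oo --> mu f.

(* sigma is the Eberlein convolution of mu and nu along A; vague limits are
   unique, so that the Eberlein convolution exists iff some sigma satisfies
   this. *)
Definition is_Eberlein_convolution (haar : {measure set (borelType G) -> \bar R})
    (An : nat -> set G) mu nu sigma : Prop :=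
  Radon_measure sigma /\
  vague_cvg
    (fun n f => real_complex R (fine (haar (An n)))^-1
       * convolution (restrict_measure mu (An n))
           (restrict_measure nu (opp_set (An n))) f)
    sigma.

Definition norm_almost_periodic K mu : Prop :=
  forall eps : R, 0 < eps ->
    relatively_dense
      [set t | (norm_on K (fun f => (mu f - translate_measure t mu f)%R)
                < eps%:E)%E].

End Measures.

(* Main.v *)
(* For open precompact A the restricted functional f |-> mu(1_A f) is a uniform
   limit of f |-> mu(p f) with p in C_c(G), 0 <= p <= 1_A and |mu|(1_A - p) small.
   If |g| <= 1_(s+U), the slice F(x) = nu(1_(-A) g(x + .)) lies in C_c(G) and is
   bounded by b = |nu|_(cl U), and up to boundary terms
     mu(1_A F) - mu(1_A F(. + t)) = (mu - tau_t mu)(1_A F).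
   A packing by translates of a small symmetric W covers A by about |A| / |W|
   translates of K, and the symmetric difference of A and A - t by o(|A|) of
   them, by the van Hove property. Dividing by |A_n| and letting n grow gives
     |sigma - tau_t sigma|_K <= b / |W| * |mu - tau_t mu|_K,
   so the almost periods of mu are almost periods of sigma. *)
Require Import Defs.
From HB Require Import structures.
From mathcomp Require Import all_boot all_order all_algebra.
From mathcomp Require Import complex.
From mathcomp Require Import all_classical all_reals all_analysis.
From mathcomp Require Import ring lra.

Set Implicit Arguments.
Unset Strict Implicit.
Unset Printing Implicit Defensive.

Import Order.TTheory GRing.Theory Num.Theory.
Import numFieldNormedType.Exports.

Local Open Scope classical_set_scope.
Local Open Scope ring_scope.

Local Notation "'Cplx' R" := ((R[i])^o)%type (at level 10, only parsing).
Local Notation "x %:Cx" := (real_complex _ x : (_[i])^o)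
  (at level 2, only parsing).

(** * The modulus of complex numbers *)

Section Modulus.
Context {R : realType}.
Implicit Types z w : Cplx R.

(** Measures are functionals on C_c(G), and estimates for |mu| rest on the subadditivity of the
    upper integral on lower semicontinuous functions. Indicators are therefore handled on open sets:
    K is enlarged to an open U to bound sigma, and the sets W - W that cover A are open. The size of
    W is tied to K: disjoint translates of W can be counted by Haar measure, a maximal disjoint
    family covers only once W is enlarged to W - W, and a translate of W - W has to fit into K. The
    translation by t acts on the outer variable of the double integral alone; hence nu contributes
    only its bound b, uniform in n, in s and in x. The boundary terms carry the norm of mu itself
    instead of that of mu - tau_t mu, which is where translation boundedness of mu enters; they
    vanish in the limit. Since b / |W| does not depend on t, a threshold for mu can be fixed in
    advance. *)

Lemma modulusE z : `|z| = real_complex R (modulus z).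
Proof. by case: z => a b. Qed.

Lemma modulus_real (x : R) : modulus (real_complex R x) = `|x|.
Proof. by rewrite /modulus /= expr0n addr0 sqrtr_sqr. Qed.

Lemma modulus0 : modulus (0 : Cplx R) = 0.
Proof. by rewrite /modulus ComplexField.Normc.normc0. Qed.

Lemma modulus_ge0 z : 0 <= modulus z.
Proof. by rewrite -ler0c -modulusE normr_ge0. Qed.

Lemma modulus_eq0 z : modulus z = 0 -> z = 0.
Proof. exact: ComplexField.Normc.eq0_normc. Qed.

Lemma modulusD z w : modulus (z + w) <= modulus z + modulus w.
Proof. exact: le_normcD. Qed.

Lemma modulusN z : modulus (- z) = modulus z.
Proof. exact: normcN. Qed.

Lemma modulusB z w : modulus (z - w) = modulus (w - z).
Proof. by rewrite -modulusN opprB. Qed.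

Lemma modulusM z w : modulus (z * w) = modulus z * modulus w.
Proof. exact: ComplexField.Normc.normcM. Qed.

Lemma modulus_dist w z : `|modulus z - modulus w| <= modulus (z - w).
Proof.
rewrite ler_norml; have := modulusD (z - w) w; have := modulusD (w - z) z.
rewrite !subrK (modulusB w z); lra.
Qed.

Lemma modulus_triangle w z v : modulus (z - v) <= modulus (z - w) + modulus (w - v).
Proof. by rewrite -[z - v](subrKA w) modulusD. Qed.

Lemma cvg_modulusP {T : Type} {F : set_system T} {FF : Filter F}
    (f : T -> Cplx R) z :
  f @ F --> z <-> forall e, 0 < e -> \forall t \near F, modulus (z - f t) < e.
Proof.
split=> [/cvgrPdist_lt fz e e0|fz].
  have : 0 < real_complex R e by rewrite ltcR.
  move=> /fz; apply: filterS => t; by rewrite modulusE ltcR.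
apply/cvgrPdist_lt => e e0.
have eE : e = real_complex R (complex.Re e).
  by apply/esym/RRe_real; exact: gtr0_real.
have : 0 < complex.Re e by rewrite -ltcR -eE.
move=> /fz; apply: filterS => t; by rewrite modulusE eE ltcR.
Qed.

Lemma cvg_modulus {T : Type} {F : set_system T} {FF : Filter F}
    (f : T -> Cplx R) z : f @ F --> z -> modulus (f t) @[t --> F] --> modulus z.
Proof.
move=> /cvg_modulusP fz; apply/cvgrPdist_lt => e /fz.
by apply: filterS => t; apply: le_lt_trans; exact: modulus_dist.
Qed.

Lemma cvg_real_complex {T : Type} {F : set_system T} {FF : Filter F}
    (f : T -> R) x :
  f @ F --> x -> (real_complex R (f t) : Cplx R) @[t --> F] --> (real_complex R x : Cplx R).
Proof.
move=> /cvgrPdist_lt fx; apply/cvg_modulusP => e /fx.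
by apply: filterS => t; rewrite -rmorphB modulus_real.
Qed.

Lemma Re_modulus z : `|complex.Re z| <= modulus z.
Proof.
by case: z => a b /=; rewrite -sqrtr_sqr ler_sqrt ?lerDl ?addr_ge0 ?sqr_ge0.
Qed.

Lemma Im_modulus z : `|complex.Im z| <= modulus z.
Proof.
by case: z => a b /=; rewrite -sqrtr_sqr ler_sqrt ?lerDr ?addr_ge0 ?sqr_ge0.
Qed.

Lemma modulus_le z : modulus z <= `|complex.Re z| + `|complex.Im z|.
Proof.
case: z => a b /=; rewrite -[X in _ <= X]ger0_norm ?addr_ge0//.
rewrite -sqrtr_sqr ler_sqrt ?sqr_ge0// sqrrD !real_normK ?num_real//.
by rewrite addrAC lerDl mulrn_wge0// mulr_ge0.
Qed.

(** Completeness is taken from the real line, through real and imaginary parts. The rate [e n]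
    survives for the limit because [e m] vanishes as m grows; the explicit rate is what later
    identifies an integral. *)
Lemma modulus_complete (u : nat -> Cplx R) (e : nat -> R) :
  e @ \oo --> 0 -> (forall m n, modulus (u m - u n) <= e m + e n) ->
  exists z, forall n, modulus (z - u n) <= e n.
Proof.
move=> e0 ue.
have cvgu (p : Cplx R -> R) : {morph p : x y / x - y} ->
    (forall z, `|p z| <= modulus z) -> cvgn (p \o u).
  move=> pB pm; apply/cauchy_cvgP/cauchy_exP => d d0.
  have d2 : 0 < d / 2 by lra.
  move/cvgrPdist_lt : e0 => /(_ _ d2) [N _ ed]; exists (p (u N)), N => // n Nn.
  change (`|p (u N) - p (u n)| < d).
  rewrite -pB; apply: le_lt_trans (pm _) _; apply: le_lt_trans (ue _ _) _.
  have := ed _ (leqnn N); have := ed _ Nn.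
  rewrite !sub0r !normrN !ltr_norml; lra.
have /cvg_ex[a ua] := cvgu (@complex.Re R) (fun x y => raddfB _ x y) Re_modulus.
have /cvg_ex[b ub] := cvgu (@complex.Im R) (fun x y => raddfB _ x y) Im_modulus.
exists (a +i* b)%C => n; apply/ler_addgt0Pr => d d0.
have d3 : 0 < d / 3 by lra.
move/cvgrPdist_lt : ua => /(_ _ d3) ua; move/cvgrPdist_lt : ub => /(_ _ d3) ub.
move/cvgrPdist_lt : e0 => /(_ _ d3) ed.
near \oo => m.
apply: le_trans (modulus_triangle (u m) _ _) _.
have := modulus_le ((a +i* b)%C - u m : Cplx R); rewrite raddfB [complex.Im _]raddfB /=.
have : `|a - complex.Re (u m)| < d / 3 by near: m.
have : `|b - complex.Im (u m)| < d / 3 by near: m.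
have : `|0 - e m| < d / 3 by near: m.
rewrite sub0r normrN ltr_norml; have := ue m n; lra.
Unshelve. all: by end_near. Qed.

End Modulus.

(** * Locally compact groups and functions of compact support *)

Lemma closure_sub_closed {T : topologicalType} (A C : set T) :
  closed C -> A `<=` C -> closure A `<=` C.
Proof. by move=> cC AC x xA; apply: cC; exact: closureS xA. Qed.

Section TopologicalGroup.
Context {G : topologicalZmodType}.
Implicit Types (t x y : G) (A B C K W : set G).

Lemma shift_setE t A : shift_set t A = [set x | A (x - t)].
Proof.
apply/seteqP; split=> [_ [y Ay <-]|x /= Ax]; first by rewrite /= addrC addKr.
by exists (x - t) => //; rewrite addrC subrK.
Qed.

Lemma opp_setE A : opp_set A = [set x | A (- x)].
Proof.
apply/seteqP; split=> [_ [y Ay <-]|x /= Ax]; first by rewrite /= opprK.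
by exists (- x) => //; rewrite opprK.
Qed.

Lemma add_subset A A' B B' :
  A `<=` A' -> B `<=` B' -> add_set A B `<=` add_set A' B'.
Proof. by move=> AA BB _ [a /AA Aa [b /BB Bb <-]]; exists a => //; exists b. Qed.

Lemma continuousDl t : continuous (fun x => t + x).
Proof.
move=> x; apply: (@continuous_comp _ _ _ (fun x => (t, x)) (fun z : G * G => z.1 + z.2)).
  by apply: cvg_pair => /=; [exact: cvg_cst|exact: cvg_id].
exact: add_continuous.
Qed.

Lemma continuousDr t : continuous (fun x => x + t).
Proof. by under eq_fun do rewrite addrC; exact: continuousDl. Qed.

Lemma open_shift t A : open A -> open (shift_set t A).
Proof. by rewrite shift_setE => oA; apply: open_comp => // x _; exact: continuousDr. Qed.

Lemma open_opp A : open A -> open (opp_set A).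
Proof. by rewrite opp_setE => oA; apply: open_comp => // x _; exact: opp_continuous. Qed.

Lemma continuous_image_compact {T U : topologicalType} (f : T -> U) (D : set T) :
  continuous f -> compact D -> compact (f @` D).
Proof. by move=> fc; apply: continuous_compact; apply: continuous_subspaceT. Qed.

Lemma compact_shift t K : compact K -> compact (shift_set t K).
Proof. by apply: continuous_image_compact; exact: continuousDl. Qed.

Lemma compact_opp K : compact K -> compact (opp_set K).
Proof. by apply: continuous_image_compact; exact: opp_continuous. Qed.

Lemma compact_add A B : compact A -> compact B -> compact (add_set A B).
Proof.
move=> cA cB; have -> : add_set A B = (fun z : G * G => z.1 + z.2) @` (A `*` B).
  apply/seteqP; split=> [_ [a Aa [b Bb <-]]|_ [[a b] [/= Aa Bb] <-]].
    by exists (a, b).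
  by exists a => //; exists b.
by apply: continuous_image_compact; [exact: add_continuous|exact: compact_setX].
Qed.

Lemma compact_closure_sub A C : hausdorff_space G -> compact C -> A `<=` C ->
  compact (closure A).
Proof.
move=> hausG cC AC; apply: (subclosed_compact _ cC); first exact: closed_closure.
by apply: closure_sub_closed => //; exact: compact_closed.
Qed.

(** For p outside C + K and k in K, q - k' stays off C when q is near p and k' near k; compactness
    of K makes one neighbourhood of p serve for all k. This gives the measurability of the second
    piece of the van Hove boundary. *)
Lemma closed_add_compact C K : closed C -> compact K -> closed (add_set C K).
Proof.
move=> cC /compact_near_coveringP cK p pCK.
apply: contrapT => npCK.
have /cK : forall k, K k -> \forall k' \near k & q \near nbhs p, ~ C (q - k').
  move=> k Kk.
  have nCpk : ~ C (p - k).
    by move=> Cpk; apply: npCK; exists (p - k) => //; exists k => //; rewrite subrK.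
  have : nbhs (p - k) (~` C).
    by apply: open_nbhs_nbhs; split => //; exact: closed_openC.
  by move=> /(@sub_continuous G (p, k)) [[U V] /= [Up Vk] UV];
    exists (V, U) => // -[k' q] /= [Vk' Uq]; apply: (UV (q, k')).
by move=> /pCK [_ [[c Cc [k Kk <-]]]] /(_ k Kk); rewrite addrK.
Qed.

Lemma locally_compact_nbhs (lcG : locally_compact [set: G]) x V :
  nbhs x V -> exists W, [/\ open W, W x, W `<=` V & compact (closure W)].
Proof.
move=> Vx; have := lcG x I; rewrite withinET => -[U Ux [cU clU]].
exists (interior (U `&` V)); split.
- exact: open_interior.
- by apply: nbhs_singleton; apply: nbhs_interior; exact: filterI.
- by move=> y /interior_subset [].
- apply: (subclosed_compact _ cU); first exact: closed_closure.
  by apply: closure_sub_closed => // y /interior_subset [].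
Qed.

End TopologicalGroup.

(** * Continuous functions of compact support *)

Section CompactSupport.
Context {R : realType} {G : topologicalZmodType}.
Implicit Types (t x y : G) (A B C K W : set G) (f g h : G -> Cplx R) (p q : G -> R).

(** The codomains are kept apart so that compact support passes between complex functions and real
    ones, such as moduli. *)
Lemma Cc_sub {V V' V'' : topologicalZmodType} (f : G -> V) (g : G -> V')
    (h : G -> V'') :
  continuous h -> Cc f -> Cc g -> (forall x, f x = 0 -> g x = 0 -> h x = 0) -> Cc h.
Proof.
move=> hc [_ fc] [_ gc] fgh; split=> //.
apply: (subclosed_compact _ (compactU fc gc)); first exact: closed_closure.
rewrite -closureU; apply: closureS => x /= /eqP hx.
have [fx|/eqP] := eqVneq (f x) 0; last by left; apply/eqP.
by right; apply/eqP => gx; apply/hx/fgh.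
Qed.

Lemma Cc_le {V V' : topologicalZmodType} (f : G -> V) (h : G -> V') :
  continuous h -> Cc f -> (forall x, f x = 0 -> h x = 0) -> Cc h.
Proof. by move=> hc fc fh; apply: (Cc_sub hc fc fc) => x /fh. Qed.

Lemma Cc_support {V : topologicalZmodType} (f : G -> V) : Cc f ->
  exists C, [/\ compact C, closed C & forall x, ~ C x -> f x = 0].
Proof.
move=> [_ fc]; exists (closure [set x | f x != 0]); split => //.
  exact: closed_closure.
by move=> x nx; apply/eqP; apply: contrapT => /negP fx; apply/nx/subset_closure.
Qed.

Lemma compact_Cc {V : topologicalZmodType} (f : G -> V) C : continuous f ->
  compact C -> closed C -> (forall x, ~ C x -> f x = 0) -> Cc f.
Proof.
move=> fc cC clC fC; split=> //.
apply: (subclosed_compact _ cC); first exact: closed_closure.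
apply: closure_sub_closed => // x /= /eqP fx.
by apply: contrapT => /fC.
Qed.

Lemma continuous_modulus f : continuous f -> continuous (fun x => modulus (f x)).
Proof. by move=> fc x; apply: cvg_modulus; exact: fc. Qed.

Lemma continuous_real_complex p :
  continuous p -> continuous (fun x => (p x)%:Cx).
Proof. by move=> pc x; apply: cvg_real_complex; exact: pc. Qed.

Lemma Cc_modulus f : Cc f -> Cc (fun x => modulus (f x)).
Proof.
move=> fc; apply: (Cc_le _ fc); first by apply: continuous_modulus; case: fc.
by move=> x /= ->; rewrite modulus0.
Qed.

Lemma CcD f g : Cc f -> Cc g -> Cc (fun x => f x + g x).
Proof.
move=> fc gc; apply: (Cc_sub _ fc gc); last by move=> x -> ->; rewrite addr0.
by move=> x; apply: cvgD; [exact: fc.1|exact: gc.1].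
Qed.

Lemma CcM f g : continuous g -> Cc f -> Cc (fun x => f x * g x).
Proof.
move=> gc fc; apply: (Cc_le _ fc); last by move=> x ->; rewrite mul0r.
by move=> x; apply: cvgM; [exact: fc.1|exact: gc].
Qed.

Lemma CcMr p f : continuous p -> Cc f -> Cc (fun x => (p x)%:Cx * f x).
Proof.
move=> pc fc; under eq_fun do rewrite mulrC.
by apply: CcM fc; exact: continuous_real_complex.
Qed.

Lemma CcZ (c : Cplx R) f : Cc f -> Cc (fun x => c * f x).
Proof.
move=> fc; under eq_fun do rewrite mulrC.
by apply: CcM fc; move=> x; exact: cvg_cst.
Qed.

Lemma CcN f : Cc f -> Cc (fun x => - f x).
Proof. by move=> /(CcZ (-1)); under eq_fun do rewrite mulN1r. Qed.

Lemma CcB f g : Cc f -> Cc g -> Cc (fun x => f x - g x).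
Proof. by move=> fc /CcN; exact: CcD. Qed.

Lemma Cc0 {V : topologicalZmodType} : Cc (fun _ : G => 0 : V).
Proof.
apply: (@compact_Cc _ _ set0) => //; first by move=> x; exact: cvg_cst.
- exact: compact0.
- exact: closed0.
Qed.

Lemma Cc_shift {V : topologicalZmodType} (hausG : hausdorff_space G) (f : G -> V) t :
  Cc f -> Cc (fun x => f (x + t)).
Proof.
move=> fc; have [C [cC clC fC]] := Cc_support fc.
apply: (@compact_Cc _ _ (shift_set (- t) C)).
- move=> x; apply: (@continuous_comp _ _ _ (fun x => x + t) f).
    exact: continuousDr.
  exact: fc.1.
- exact: compact_shift.
- by apply: compact_closed => //; exact: compact_shift.
- by move=> x; rewrite shift_setE /= opprK; exact: fC.
Qed.

Lemma Cc_shiftl {V : topologicalZmodType} (hausG : hausdorff_space G) (f : G -> V) t :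
  Cc f -> Cc (fun x => f (t + x)).
Proof. by under [fun x => f (t + x)]eq_fun do rewrite addrC; exact: Cc_shift. Qed.

Lemma continuous_maxr p q : continuous p -> continuous q ->
  continuous (fun x => Num.max (p x) (q x)).
Proof. by move=> pc qc x; apply: (@continuous_max _ _ p q); [exact: pc|exact: qc]. Qed.

Lemma Cc_max p q : Cc p -> Cc q -> Cc (fun x => Num.max (p x) (q x)).
Proof.
move=> pc qc; apply: (Cc_sub _ pc qc); last by move=> x -> ->; rewrite maxxx.
by apply: continuous_maxr; [exact: pc.1|exact: qc.1].
Qed.

Lemma CcMl p q : continuous q -> Cc p -> Cc (fun x => q x * p x).
Proof.
move=> qc pc; apply: (Cc_le _ pc); last by move=> x ->; rewrite mulr0.
by move=> x; apply: cvgM; [exact: qc|exact: pc.1].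
Qed.

(** Complete regularity separates x from the complement of a relatively compact open W inside V by a
    function equal to 0 at x and 1 off W; its difference from 1 vanishes off W, which gives the
    compact support. *)
Lemma bump (hausG : hausdorff_space G) (lcG : locally_compact [set: G]) x V :
  nbhs x V -> exists p : G -> R, [/\ Cc p, forall y, 0 <= p y <= 1, p x = 1
    & forall y, ~ V y -> p y = 0].
Proof.
move=> Vx; have [W [oW Wx WV cW]] := locally_compact_nbhs lcG Vx.
have clW : closed (~` W) by exact: open_closedC.
have nWx : ~ (~` W) x by apply.
have /(@uniform_separatorP _ R)[p [pc p01 px pW]] :=
  @locally_compact_completely_regular G R lcG hausG x _ clW nWx.
have pW' y : ~ W y -> 1 - p y = 0.
  by move=> nWy; rewrite (pW (p y)) ?subrr//; exists y.
exists (fun y => 1 - p y); split.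
- apply: (@compact_Cc _ _ (closure W)) => //.
  + by move=> y; apply: cvgB; [exact: cvg_cst|exact: pc].
  + exact: closed_closure.
  + by move=> y nWy; apply: pW' => /subset_closure.
- move=> y; have := p01 (p y) (ex_intro2 _ _ _ I erefl).
  by rewrite /= in_itv /= => /andP[? ?]; apply/andP; split; lra.
- by rewrite (px (p x)) ?subr0//; exists x.
- by move=> y nVy; apply: pW' => /WV.
Qed.

End CompactSupport.

(** * The upper integral of lower semicontinuous functions *)

Section UpperIntegral.
Context {R : realType} {G : topologicalZmodType}.
Hypothesis hausG : hausdorff_space G.
Implicit Types (mu : functional R G) (A B C K W : set G) (f g h : G -> Cplx R).
Implicit Types (k : G -> \bar R) (p q : G -> R).

Lemma Radon0 mu : Radon_measure mu -> mu (fun=> 0) = 0.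
Proof.
case=> _ muZ _; rewrite -[RHS](mul0r (mu (fun=> 0))) -muZ; last exact: Cc0.
by congr mu; apply/funext => x; rewrite mul0r.
Qed.

Lemma RadonN mu f : Radon_measure mu -> Cc f -> mu (fun x => - f x) = - mu f.
Proof.
case=> _ muZ _ fc; rewrite -mulN1r -muZ//.
by congr mu; apply/funext => x; rewrite mulN1r.
Qed.

Lemma RadonB mu f g : Radon_measure mu -> Cc f -> Cc g ->
  mu (fun x => f x - g x) = mu f - mu g.
Proof.
move=> muR fc gc; rewrite -RadonN//; case: muR => muD _ _.
by rewrite -muD//; exact: CcN.
Qed.

(** The two nested suprema collapse: a test function g is admissible with its own modulus as the
    intermediate f. This reduces |mu| to test functions. *)
Lemma upper_integral_lscE mu k :
  upper_integral_lsc mu k = ereal_sup [set (modulus (mu g))%:E |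
    g in [set g | Cc g /\ forall x, ((modulus (g x))%:E <= k x)%E]].
Proof.
apply/eqP; rewrite eq_le; apply/andP; split.
- apply: ge_ereal_sup => _ [p [pc pk] <-].
  apply: ge_ereal_sup => _ [g [gc gp] <-].
  apply: ereal_sup_ubound; exists g => //; split => // x.
  by apply: le_trans (pk x).2; rewrite lee_fin.
- apply: ge_ereal_sup => _ [g [gc gk] <-].
  apply: le_trans; last first.
    apply: ereal_sup_ubound; exists (fun x => modulus (g x)) => //.
    by split; [exact: Cc_modulus|move=> x; rewrite modulus_ge0].
  by apply: ereal_sup_ubound; exists g.
Qed.

Lemma le_upper_integral_lsc mu k g : Cc g ->
  (forall x, ((modulus (g x))%:E <= k x)%E) ->
  ((modulus (mu g))%:E <= upper_integral_lsc mu k)%E.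
Proof. by move=> gc gk; rewrite upper_integral_lscE; apply: ereal_sup_ubound; exists g. Qed.

Lemma upper_integral_lsc_le mu k M :
  (forall g, Cc g -> (forall x, ((modulus (g x))%:E <= k x)%E) ->
    ((modulus (mu g))%:E <= M)%E) ->
  (upper_integral_lsc mu k <= M)%E.
Proof.
move=> kM; rewrite upper_integral_lscE.
by apply: ge_ereal_sup => _ [g [gc gk] <-]; exact: kM.
Qed.

Lemma upper_integral_lsc_mono mu k k' : (forall x, (k x <= k' x)%E) ->
  (upper_integral_lsc mu k <= upper_integral_lsc mu k')%E.
Proof.
move=> kk'; apply: upper_integral_lsc_le => g gc gk.
by apply: le_upper_integral_lsc => // x; apply: le_trans (kk' x).
Qed.

Lemma upper_integral_lsc_ge0 mu k : Radon_measure mu -> (forall x, (0 <= k x)%E) ->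
  (0 <= upper_integral_lsc mu k)%E.
Proof.
move=> muR k0; have := @le_upper_integral_lsc mu k (fun=> 0) Cc0.
by rewrite Radon0// modulus0; apply.
Qed.

Lemma upper_integral_lscZ mu k (c : R) : Radon_measure mu -> 0 <= c ->
  (upper_integral_lsc mu (fun x => c%:E * k x) <= c%:E * upper_integral_lsc mu k)%E.
Proof.
(* The value c = 0 is separate: k may be infinite, and the convention that 0 times infinity is 0
   forces g = 0. *)
move=> muR; rewrite le_eqVlt => /predU1P[<-|c0];
    apply: upper_integral_lsc_le => g gc gk.
  have -> : g = fun=> 0.
    apply/funext => x; apply: modulus_eq0; apply/eqP.
    by rewrite eq_le modulus_ge0 andbT; have := gk x; rewrite mul0e lee_fin.
  by rewrite mul0e Radon0// modulus0.
rewrite -lee_pdivrMl//.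
have -> : (c^-1%:E * (modulus (mu g))%:E)%E = (modulus (mu (fun x => c^-1%:Cx * g x)))%:E.
  case: muR => _ muZ _.
  by rewrite muZ// modulusM modulus_real gtr0_norm ?invr_gt0.
apply: le_upper_integral_lsc; first exact: CcZ.
move=> x; rewrite modulusM modulus_real gtr0_norm ?invr_gt0// EFinM.
by rewrite lee_pdivrMl.
Qed.

Lemma upper_integral_le mu k : lower_semicontinuous k ->
  (upper_integral mu k <= upper_integral_lsc mu k)%E.
Proof. by move=> kc; apply: ereal_inf_lbound; exists k. Qed.

Lemma upper_integral_lt mu (h : G -> \bar R) (M : R) :
  (upper_integral mu h < M%:E)%E ->
  exists k, [/\ lower_semicontinuous k, forall x, (h x <= k x)%E
    & (upper_integral_lsc mu k < M%:E)%E].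
Proof. by move=> /ereal_inf_lt[_ [k [kc hk] <-] kM]; exists k. Qed.

Lemma upper_integral_ge mu (h : G -> \bar R) M :
  (forall k, lower_semicontinuous k -> (forall x, (h x <= k x)%E) ->
    (M <= upper_integral_lsc mu k)%E) -> (M <= upper_integral mu h)%E.
Proof. by move=> hM; apply: le_ereal_inf_tmp => _ [k [kc hk] <-]; exact: hM. Qed.

Definition lscr (u : G -> R) := lower_semicontinuous (fun x => (u x)%:E).

Lemma lscr_continuous p : continuous p -> lscr p.
Proof.
move=> pc x a; rewrite lte_fin => apx.
have := pc x; rewrite /continuous_at => /cvgrPdist_lt/(_ (p x - a)).
rewrite subr_gt0 => /(_ apx) near_x; exists [set y | `|p x - p y| < p x - a] => //.
by move=> y /=; rewrite lte_fin ltr_norml; lra.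
Qed.

Lemma lscrD p q : lscr p -> lscr q -> lscr (fun x => p x + q x).
Proof.
move=> pc qc x a; rewrite lte_fin => apq.
pose e := (p x + q x - a) / 2.
have /pc[U Ux Up] : ((p x - e)%:E < (p x)%:E)%E by rewrite lte_fin /e; lra.
have /qc[V Vx Vq] : ((q x - e)%:E < (q x)%:E)%E by rewrite lte_fin /e; lra.
exists (U `&` V); first exact: filterI.
move=> y [/Up + /Vq]; rewrite !lte_fin /e; lra.
Qed.

Lemma lscr_indic A : open A -> lscr \1_A.
Proof.
move=> oA x a; rewrite lte_fin indicE.
have [/set_mem Ax a1|_ a0] := boolP (x \in A).
  exists A; first exact: open_nbhs_nbhs.
  by move=> y Ay; rewrite lte_fin indicE mem_set.
exists setT; first exact: filterT.
by move=> y _; rewrite lte_fin (lt_le_trans a0)// indicE ler0n.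
Qed.

(** * Subadditivity by means of continuous minorants *)

Section Minorant.
Hypothesis lcG : locally_compact [set: G].

Definition minorant k p := Cc p /\ forall x, 0 <= p x /\ ((p x)%:E <= k x)%E.

(** A lower semicontinuous k >= 0 is at each point the supremum of its C_c minorants: take a bump at
    x of height just below [k x], vanishing off a neighbourhood where k exceeds that height. The cut
    at B is there because [k x] may be infinite. *)
Lemma lsc_minorant k x (B d : R) : 0 < d -> (forall x, 0 <= k x)%E ->
  lower_semicontinuous k ->
  exists2 p, minorant k p & (Order.min (k x) B%:E <= (p x + d)%:E)%E.
Proof.
move=> d0 k0 kc.
have mfin : Order.min (k x) B%:E \is a fin_num.
  rewrite fin_numE; have := k0 x.
  case: (k x) => [r| |]// _; rewrite /Order.min; by case: ifP.
pose c := fine (Order.min (k x) B%:E) - d.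
have [c0|c0] := leP c 0.
  exists (fun=> 0); first by split => //; exact: Cc0.
  rewrite add0r -(fineK mfin) lee_fin; rewrite /c in c0; lra.
have cx : (c%:E < k x)%E.
  apply: (@lt_le_trans _ _ (Order.min (k x) B%:E)); last by rewrite ge_min lexx.
  rewrite -(fineK mfin) lte_fin /c; lra.
have [V Vx Vk] := kc _ _ cx.
have [p [pc p01 px pV]] := bump (R := R) hausG lcG Vx.
exists (fun y => c * p y).
  split; first by apply: (CcMl _ pc); move=> y; exact: cvg_cst.
  move=> y; have /andP[p0 p1] := p01 y; split; first by rewrite mulr_ge0// ltW.
  have [Vy|/pV->] := pselect (V y); last by rewrite mulr0.
  by apply: le_trans (ltW (Vk _ Vy)); rewrite lee_fin ler_piMr// ltW.
by rewrite px mulr1 -(fineK mfin) lee_fin /c subrK.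
Qed.

(** Finite heights replace possibly infinite values; B will be the modulus of h at a point. *)
Lemma min_add_ge (a b : \bar R) (B : R) : (0 <= a)%E -> (0 <= b)%E -> 0 <= B ->
  (B%:E <= a + b)%E -> (B%:E <= Order.min a B%:E + Order.min b B%:E)%E.
Proof.
move=> a0 b0 B0 Bab.
have [aB|Ba] := leP a B%:E; have [bB|Bb] := leP b B%:E => //.
- by rewrite leeDr.
- by rewrite leeDl.
- by rewrite leeDl.
Qed.

Lemma compact_minorants k k' h C (d : R) : 0 < d ->
  (forall x, 0 <= k x)%E -> (forall x, 0 <= k' x)%E ->
  lower_semicontinuous k -> lower_semicontinuous k' -> continuous h -> compact C ->
  (forall x, ((modulus (h x))%:E <= k x + k' x)%E) ->
  exists p p', [/\ minorant k p, minorant k' p'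
    & forall x, C x -> modulus (h x) < p x + p' x + d].
Proof.
move=> d0 k0 k'0 kc k'c hc /compact_near_coveringP cC hk.
(* Compactness is applied to the upward directed set of pairs of minorants. *)
pose D : set ((G -> R) * (G -> R)) := [set u | minorant k u.1 /\ minorant k' u.2].
pose up (u : (G -> R) * (G -> R)) :=
  [set v | D v /\ forall x, u.1 x <= v.1 x /\ u.2 x <= v.2 x].
pose F := filter_from D up.
have minorant0 l : (forall x, 0 <= l x)%E -> minorant l (fun=> 0).
  by move=> l0; split => //; exact: Cc0.
have minorantU l p q : minorant l p -> minorant l q ->
    minorant l (fun x => Num.max (p x) (q x)).
  move=> [pc pl] [qc ql]; split; first exact: Cc_max.
  move=> x; have [? ?] := pl x; have [? ?] := ql x.
  by rewrite maxEle; case: ifP.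
have FF : ProperFilter F.
  apply: filter_from_proper.
    apply: filter_from_filter.
      by exists (fun=> 0, fun=> 0); split; exact: minorant0.
    move=> u v [uk uk'] [vk vk'].
    exists (fun x => Num.max (u.1 x) (v.1 x), fun x => Num.max (u.2 x) (v.2 x)).
      by split; exact: minorantU.
    move=> w [Dw wuv]; split; split => // x; have [] := wuv x => /=;
      by rewrite !ge_max => /andP[? ?] /andP[? ?].
  by move=> u Du; exists u; split.
have D0 : D (fun=> 0, fun=> 0) by split; exact: minorant0.
have FD : F D by exists (fun=> 0, fun=> 0) => // u [].
suff /(filterI FD)/filter_ex[u [[uk uk'] uh]] :
    F [set u | C `<=` [set x | modulus (h x) < u.1 x + u.2 x + d]].
  by exists u.1, u.2.
apply: (cC _ F (fun u x => modulus (h x) < u.1 x + u.2 x + d)) => x Cx.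
(* The budget d: a loss of d / 4 for each of the two minorants at x, then d / 8 for each of p, q and
   h in moving from x to y. *)
have d4 : 0 < d / 4 by lra.
have [p pk px] := lsc_minorant x (modulus (h x)) d4 k0 kc.
have [q qk qx] := lsc_minorant x (modulus (h x)) d4 k'0 k'c.
have : modulus (h x) <= p x + q x + d / 2.
  rewrite -lee_fin; apply: le_trans (min_add_ge _ _ _ (hk x)) _ => //.
    exact: modulus_ge0.
  apply: le_trans (leeD px qx) _; rewrite -EFinD lee_fin; lra.
have pc := pk.1.1; have qc := qk.1.1.
have d8 : 0 < d / 8 by lra.
move=> hpq; near=> y u => /=.
have : up (p, q) u by near: u; exists (p, q).
move=> [_ /(_ y)/= [? ?]].
have : `|p x - p y| < d / 8 by near: y; move/cvgrPdist_lt : (pc x); apply.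
have : `|q x - q y| < d / 8 by near: y; move/cvgrPdist_lt : (qc x); apply.
have : modulus (h x - h y) < d / 8 by near: y; move/cvg_modulusP : (hc x); apply.
have := modulus_dist (h y) (h x); rewrite !ltr_norml ler_norml; lra.
Unshelve. all: by end_near. Qed.

(** A test function h below k + k' has to be cut into test functions below k and below k'. The
    quotients k / (k + k') need not be continuous, so continuous minorants p and q take over; the
    remaining piece, of modulus at most d, is absorbed by the bound of mu on the support of h. *)
Theorem upper_integral_lscD mu k k' : Radon_measure mu ->
  (forall x, 0 <= k x)%E -> (forall x, 0 <= k' x)%E ->
  lower_semicontinuous k -> lower_semicontinuous k' ->
  (upper_integral_lsc mu (fun x => k x + k' x)%E <=
   upper_integral_lsc mu k + upper_integral_lsc mu k')%E.
Proof.
move=> muR k0 k'0 kc k'c; apply: upper_integral_lsc_le => h hC hk.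
have [C [cC clC hout]] := Cc_support hC.
have [muD _ /(_ C cC)[M muM]] := muR.
apply/lee_addgt0Pr => e e0.
pose d := e / (`|M| + 1).
have M1 : 0 < `|M| + 1 by rewrite ltr_wpDl.
have d0 : 0 < d by rewrite divr_gt0.
have [p [q [pk qk hpq]]] := compact_minorants d0 k0 k'0 kc k'c hC.1 cC hk.
have s0 x : 0 < p x + q x + d by have := (pk.2 x).1; have := (qk.2 x).1; lra.
(* h is split proportionally to p, q and d. *)
pose part (r : G -> R) x := (r x / (p x + q x + d))%:Cx * h x.
have sc : continuous (fun x => (p x + q x + d)^-1).
  move=> x; apply: cvgV; first by rewrite gt_eqF.
  by apply: cvgD; [apply: cvgD; [exact: pk.1.1|exact: qk.1.1]|exact: cvg_cst].
have partC r : continuous r -> Cc (part r).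
  by move=> rc; apply: CcMr hC; move=> x; apply: cvgM; [exact: rc|exact: sc].
have part_le r x : 0 <= r x -> modulus (part r x) <= r x.
  move=> r0; rewrite modulusM modulus_real ger0_norm; last by rewrite divr_ge0// ltW.
  rewrite mulrAC ler_pdivrMr// ler_wpM2l//.
  by have [/hpq/ltW//|/hout->] := pselect (C x); rewrite modulus0 ltW.
have hE : h = fun x => part p x + part q x + part (fun=> d) x.
  apply/funext => x; rewrite -!mulrDl -!rmorphD -!mulrDl divff ?gt_eqF//.
  by rewrite rmorph1 mul1r.
have pC := partC _ pk.1.1; have qC := partC _ qk.1.1.
have dC : Cc (part (fun=> d)) by apply: partC => x; exact: cvg_cst.
rewrite hE muD//; last exact: CcD.
rewrite muD//; apply: (@le_trans _ _ ((modulus (mu (part p)))%:E +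
  (modulus (mu (part q)))%:E + (modulus (mu (part (fun=> d))))%:E)%E).
  rewrite -!EFinD lee_fin; apply: le_trans (modulusD _ _) _.
  by rewrite lerD2r modulusD.
apply: leeD; first apply: leeD.
- apply: le_upper_integral_lsc => // x; apply: le_trans (pk.2 x).2.
  by rewrite lee_fin part_le// (pk.2 x).1.
- apply: le_upper_integral_lsc => // x; apply: le_trans (qk.2 x).2.
  by rewrite lee_fin part_le// (qk.2 x).1.
- rewrite lee_fin; apply: (@le_trans _ _ (M * d)).
    apply: muM => // [x /hout hx|x]; first by rewrite /part hx mulr0.
    by rewrite part_le// ltW.
  rewrite /d mulrA ler_pdivrMr// mulrC ler_pM2l//.
  by have := ler_norm M; lra.
Qed.

End Minorant.

End UpperIntegral.

(** * Restriction to open precompact sets *)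

(** Multiplying w by a unit that gives it the argument of z removes all cancellation. Two test
    functions with |g1| + |g2| <= 1_A can then be merged into one for which the moduli of their
    integrals add. *)
Lemma phase {R : realType} (z w : Cplx R) :
  exists2 c : Cplx R, modulus c = 1 & modulus (z + c * w) = modulus z + modulus w.
Proof.
have m1 : modulus (1 : Cplx R) = 1 by exact: ComplexField.Normc.normc1.
have mV (v : Cplx R) : modulus v^-1 = (modulus v)^-1 by exact: ComplexField.Normc.normcV.
have [->|w0] := eqVneq w 0.
  by exists 1; rewrite // mulr0 addr0 modulus0 addr0.
have [->|z0] := eqVneq z 0.
  by exists 1; rewrite // mul1r add0r modulus0 add0r.
have mw : 0 < modulus w.
  by rewrite lt_def modulus_ge0 andbT; apply: contra_neq w0; exact: modulus_eq0.
have mz : 0 < modulus z.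
  by rewrite lt_def modulus_ge0 andbT; apply: contra_neq z0; exact: modulus_eq0.
exists (z * (modulus w / modulus z)%:Cx * w^-1).
  rewrite !modulusM modulus_real mV gtr0_norm ?divr_gt0//.
  by field; rewrite !gt_eqF.
rewrite mulfVK// -[X in X + _]mulr1 -mulrDr modulusM.
have -> : 1 + (modulus w / modulus z)%:Cx = (1 + modulus w / modulus z)%:Cx.
  by rewrite rmorphD rmorph1.
rewrite modulus_real gtr0_norm ?addr_gt0 ?divr_gt0//.
by rewrite mulrDr mulr1 mulrCA divff ?mulr1 ?gt_eqF.
Qed.

Section Restriction.
Context {R : realType} {G : topologicalZmodType}.
Hypothesis hausG : hausdorff_space G.
Hypothesis lcG : locally_compact [set: G].
Implicit Types (mu : functional R G) (A B C K W : set G) (f g h : G -> Cplx R).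
Implicit Types (k : G -> \bar R) (p q : G -> R).

Lemma upper_integral_indic_lty mu A : Radon_measure mu -> compact (closure A) ->
  (upper_integral_lsc mu (fun x => (\1_A x)%:E) < +oo)%E.
Proof.
move=> [_ _ muK] /muK[M muM]; apply: (@le_lt_trans _ _ M%:E); last exact: ltry.
apply: upper_integral_lsc_le => g gc gA; rewrite lee_fin -[M]mulr1.
apply: muM => // x.
  move=> nAx; apply: modulus_eq0; apply/eqP; rewrite eq_le modulus_ge0 andbT.
  rewrite -lee_fin (le_trans (gA x))// lee_fin indicE memNset// => Ax.
  exact/nAx/subset_closure.
by rewrite -lee_fin (le_trans (gA x))// lee_fin indicE lern1 leq_b1.
Qed.

(* If |g0| <= 1_A nearly maximises |mu g0| and p = |g0| / (|g0| + d) is nearly 1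
   where g0 is not small, then |mu (p g0)| is still nearly maximal; a g with
   |g| <= 1_A - p can be added to p g0 with an optimal phase, so mu g is small. *)
Lemma approx_indic mu A (e : R) : Radon_measure mu -> open A -> compact (closure A) ->
  0 < e -> exists p, [/\ Cc p, forall x, 0 <= p x <= \1_A x
    & (upper_integral_lsc mu (fun x => (\1_A x - p x)%:E) <= e%:E)%E].
Proof.
move=> muR oA cA e0; have Ioo := upper_integral_indic_lty muR cA.
have I0 : (0 <= upper_integral_lsc mu (fun x => (\1_A x)%:E))%E.
  by apply: upper_integral_lsc_ge0 => // x; rewrite lee_fin indicE ler0n.
pose S := fine (upper_integral_lsc mu (fun x => (\1_A x)%:E)).
have IE : upper_integral_lsc mu (fun x => (\1_A x)%:E) = S%:E.
  by rewrite fineK// ge0_fin_numE.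
have [muD muZ /(_ _ cA)[M muM]] := muR.
have [g0 [g0c g0A] g0S] : exists2 g0, Cc g0 /\ (forall x, modulus (g0 x) <= \1_A x)
    & S - e / 2 < modulus (mu g0).
  have : ((S - e / 2)%:E < upper_integral_lsc mu (fun x => (\1_A x)%:E))%E.
    rewrite IE lte_fin; lra.
  rewrite upper_integral_lscE => /ereal_sup_gt[_ [g [gc gA] <-]].
  by rewrite lte_fin => gS; exists g.
have M1 : 0 < `|M| + 1 by rewrite ltr_wpDl.
(* With this d, |(1 - p) g0| = d |g0| / (|g0| + d) <= d, so passing from g0 to p g0 costs at most M
   d <= e / 2; g0 misses the supremum by less than another e / 2. *)
pose d := e / 2 / (`|M| + 1).
have d0 : 0 < d by rewrite !divr_gt0.
have s0 x : 0 < modulus (g0 x) + d by rewrite ltr_wpDl// modulus_ge0.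
pose p x := (modulus (g0 x) + d)^-1 * modulus (g0 x).
have sc : continuous (fun x => (modulus (g0 x) + d)^-1).
  move=> x; apply: cvgV; first by rewrite gt_eqF.
  by apply: cvgD; [exact: (Cc_modulus g0c).1|exact: cvg_cst].
have pC : Cc p by apply: CcMl => //; exact: Cc_modulus.
have pA x : 0 <= p x <= \1_A x.
  apply/andP; split.
    by rewrite mulr_ge0 ?modulus_ge0// invr_ge0 ltW.
  rewrite /p; have := g0A x; rewrite indicE; case: (x \in A) => /= gx.
    by rewrite mulrC ler_pdivrMr// mul1r lerDl ltW.
  suff -> : modulus (g0 x) = 0 by rewrite mulr0.
  by apply/eqP; rewrite eq_le gx modulus_ge0.
exists p; split => //; apply: upper_integral_lsc_le => g gc gp.
have pgC : Cc (fun x => (p x)%:Cx * g0 x) by apply: CcMr => //; exact: pC.1.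
have [c c1 cE] := phase (mu (fun x => (p x)%:Cx * g0 x)) (mu g).
have : modulus (mu (fun x => (p x)%:Cx * g0 x)) + modulus (mu g) <= S.
  rewrite -cE -muZ// -muD//; last exact: CcZ.
  rewrite -lee_fin -IE; apply: le_upper_integral_lsc.
    by apply: CcD => //; exact: CcZ.
  move=> x; rewrite lee_fin; apply: le_trans (modulusD _ _) _.
  rewrite !modulusM c1 mul1r modulus_real.
  have := gp x; rewrite lee_fin; have /andP[p0 p1] := pA x.
  have : modulus (g0 x) <= 1.
    by apply: le_trans (g0A x) _; rewrite indicE lern1 leq_b1.
  rewrite ger0_norm//; have := modulus_ge0 (g0 x); nra.
have : modulus (mu g0 - mu (fun x => (p x)%:Cx * g0 x)) <= e / 2.
  rewrite -RadonB//; apply: (@le_trans _ _ (M * d)).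
    apply: muM; first exact: CcB.
      move=> x nAx; suff -> : g0 x = 0 by rewrite mulr0 subr0.
      apply: modulus_eq0; apply/eqP; rewrite eq_le modulus_ge0 andbT.
      rewrite (le_trans (g0A x))// indicE memNset// => Ax.
      exact/nAx/subset_closure.
    move=> x; rewrite -[X in X - _]mul1r -mulrBl modulusM -(rmorph1 (real_complex R)).
    rewrite -rmorphB modulus_real.
    have -> : 1 - p x = d / (modulus (g0 x) + d).
      by rewrite /p mulrC -[X in X - _](divff (lt0r_neq0 (s0 x))) -mulrBl addrC addKr.
    rewrite ger0_norm; last by rewrite divr_ge0// ltW.
    by rewrite mulrAC ler_pdivrMr// ler_pM2l// lerDl ltW.
  rewrite /d mulrA ler_pdivrMr// mulrC ler_pM2l ?divr_gt0//.
  by have := ler_norm M; lra.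
have := modulusD (mu g0 - mu (fun x => (p x)%:Cx * g0 x)) (mu (fun x => (p x)%:Cx * g0 x)).
by rewrite subrK lee_fin; lra.
Qed.

Let trunc A f : G -> Cplx R := fun x => if x \in A then f x else 0.

Lemma lscr_indicB A p : open A -> Cc p -> lscr (fun x => \1_A x - p x).
Proof.
move=> oA pc; apply: lscrD; first exact: lscr_indic.
by apply: lscr_continuous => x; apply: cvgN; exact: pc.1.
Qed.

Lemma lscrZ (c : R) p : 0 <= c -> lscr p -> lscr (fun x => c * p x).
Proof.
rewrite le_eqVlt => /predU1P[<- _|c0 pc].
  by under eq_fun do rewrite mul0r; apply: lscr_continuous => x; exact: cvg_cst.
move=> x a; rewrite lte_fin -ltr_pdivrMl// => cax.
have /pc[V Vx Vp] : ((c^-1 * a)%:E < (p x)%:E)%E by [].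
by exists V => // y /Vp; rewrite !lte_fin -ltr_pdivrMl.
Qed.

Lemma modulus_truncB A p f (b : R) : (forall x, 0 <= p x <= \1_A x) -> 0 <= b ->
  (forall x, A x -> modulus (f x) <= b) ->
  forall x, modulus (trunc A f x - (p x)%:Cx * f x) <= b * (\1_A x - p x).
Proof.
move=> pA b0 fb x; have := pA x; rewrite /trunc indicE.
case: ifPn => /= [/set_mem/fb fx /andP[p0 p1]|_ p0].
  rewrite -[X in X - _]mul1r -mulrBl modulusM -(rmorph1 (real_complex R)) -rmorphB.
  rewrite modulus_real ger0_norm ?subr_ge0// mulrC ler_wpM2r// subr_ge0//.
have -> : p x = 0 by apply/eqP; rewrite eq_le andbC.
by rewrite mul0r !subr0 modulus0 mulr0.
Qed.

(** The approximants g granted by [is_integral] bear no relation to A or p; they are compared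
    through |g - p f| <= |g - 1_A f| + b (1_A - p) and subadditivity. As this holds for every
    integral z, it holds for the one that [xget] picks. *)
Lemma is_integral_trunc_dist mu A p f (b : R) z : Radon_measure mu -> open A ->
  Cc p -> (forall x, 0 <= p x <= \1_A x) -> Cc f -> 0 <= b ->
  (forall x, A x -> modulus (f x) <= b) -> is_integral mu (trunc A f) z ->
  ((modulus (z - mu (fun x => (p x)%:Cx * f x)))%:E <=
   b%:E * upper_integral_lsc mu (fun x => (\1_A x - p x)%:E))%E.
Proof.
move=> muR oA pc pA fc b0 fb zP.
have pfC : Cc (fun x => (p x)%:Cx * f x) by apply: CcMr => //; exact: pc.1.
apply/lee_addgt0Pr => e e0; have e3 : 0 < e / 3 by lra.
have [g [gc gI gz]] := zP _ e3.
(* Subadditivity needs lower semicontinuity, so |1_A f - g| is replaced by a majorant k, at the cost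
   of another e / 3. *)
have [k [kc kge kI]] : exists k, [/\ lower_semicontinuous k,
    forall x, ((modulus (trunc A f x - g x))%:E <= k x)%E
    & (upper_integral_lsc mu k < (e / 3 + e / 3)%:E)%E].
  by apply: upper_integral_lt; apply: le_lt_trans gI _; rewrite lte_fin; lra.
have k0 x : (0 <= k x)%E by apply: le_trans (kge x); rewrite lee_fin modulus_ge0.
have bd0 x : (0 <= (b * (\1_A x - p x))%:E)%E.
  by rewrite lee_fin mulr_ge0// subr_ge0; case/andP: (pA x).
have bdc : lscr (fun x => b * (\1_A x - p x)) by apply: lscrZ => //; exact: lscr_indicB.
have gpf : ((modulus (mu g - mu (fun x => (p x)%:Cx * f x)))%:E <=
    upper_integral_lsc mu k +
    b%:E * upper_integral_lsc mu (fun x => (\1_A x - p x)%:E))%E.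
  rewrite -RadonB//; apply: (@le_trans _ _
    (upper_integral_lsc mu k + upper_integral_lsc mu (fun x => (b * (\1_A x - p x))%:E))%E).
    apply: le_trans (upper_integral_lscD hausG lcG muR k0 bd0 kc bdc).
    apply: le_upper_integral_lsc; first exact: CcB.
    move=> x; apply: le_trans (leeD (kge x) (lexx _)); rewrite -EFinD lee_fin.
    apply: le_trans (modulus_triangle (trunc A f x) _ _) _.
    by rewrite modulusB lerD2l; exact: modulus_truncB.
  rewrite leeD2l//; under [X in upper_integral_lsc _ X]eq_fun do rewrite EFinM.
  exact: upper_integral_lscZ.
apply: (@le_trans _ _ ((modulus (z - mu g))%:E +
    (modulus (mu g - mu (fun x => (p x)%:Cx * f x)))%:E)%E).
  by rewrite -EFinD lee_fin; exact: modulus_triangle.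
apply: (@le_trans _ _ ((e / 3)%:E + ((e / 3 + e / 3)%:E +
    b%:E * upper_integral_lsc mu (fun x => (\1_A x - p x)%:E)))%E).
  apply: leeD; first by rewrite lee_fin.
  by apply: le_trans gpf _; rewrite leeD2r// ltW.
rewrite addeA addeC -EFinD leeD2l// lee_fin; lra.
Qed.

(** The integral is the limit of mu(p_n f) for cutoffs p_n that exhaust A. The sequence is Cauchy
    because p_m - p_n = p_m (1 - p_n) - p_n (1 - p_m), where the two products are at most 1_A - p_n
    and 1_A - p_m. *)
Lemma is_integral_trunc_ex mu A f (b : R) : Radon_measure mu -> open A ->
  compact (closure A) -> Cc f -> (forall x, A x -> modulus (f x) <= b) ->
  exists z, is_integral mu (trunc A f) z.
Proof.
(* b may be 0, or negative when A is empty; c is a positive bound by which one can divide. *)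
move=> muR oA cA fc fb; pose c := `|b| + 1.
have c0 : 0 < c by rewrite ltr_wpDl.
have fcb x : A x -> modulus (f x) <= c.
  by move=> /fb; rewrite /c; have := ler_norm b; lra.
have /choice[p pP] (n : nat) : exists p, [/\ Cc p, forall x, 0 <= p x <= \1_A x
    & (upper_integral_lsc mu (fun x => (\1_A x - p x)%:E) <= (n.+1%:R^-1 / c)%:E)%E].
  by apply: approx_indic => //; rewrite divr_gt0// invr_gt0.
have pC n := let: And3 pC _ _ := pP n in pC.
have pA n := let: And3 _ pA _ := pP n in pA.
have pI n : (upper_integral_lsc mu (fun x => (c * (\1_A x - p n x))%:E) <= n.+1%:R^-1%:E)%E.
  under [X in upper_integral_lsc _ X]eq_fun do rewrite EFinM.
  apply: le_trans (upper_integral_lscZ _ muR (ltW c0)) _.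
  by rewrite -lee_pdivlMl// -EFinM mulrC; case: (pP n).
have pfC n : Cc (fun x => (p n x)%:Cx * f x) by apply: CcMr => //; exact: (pC n).1.
have part_le m n : modulus (mu (fun x => (p m x * (1 - p n x))%:Cx * f x)) <= n.+1%:R^-1.
  rewrite -lee_fin; apply: le_trans (pI n); apply: le_upper_integral_lsc.
    apply: CcMr fc => x; apply: cvgM; first exact: (pC m).1.
    by apply: cvgB; [exact: cvg_cst|exact: (pC n).1].
  move=> x; rewrite lee_fin modulusM modulus_real.
  have := pA m x; have := pA n x; rewrite indicE.
  have [/set_mem/fcb fx /= /andP[n0 n1] /andP[m0 m1]|_ /= n0 m0] := boolP (x \in A).
    rewrite ger0_norm ?mulr_ge0 ?subr_ge0// mulrC ler_pM ?modulus_ge0 ?mulr_ge0 ?subr_ge0//.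
    by rewrite ler_piMl// subr_ge0.
  have -> : p m x = 0 by apply/eqP; rewrite eq_le andbC.
  have -> : p n x = 0 by apply/eqP; rewrite eq_le andbC.
  by rewrite mul0r normr0 mul0r subr0 mulr0.
have partC m n : Cc (fun x => (p m x * (1 - p n x))%:Cx * f x).
  apply: CcMr fc => x; apply: cvgM; first exact: (pC m).1.
  by apply: cvgB; [exact: cvg_cst|exact: (pC n).1].
have [z zu] : exists z, forall n, modulus (z - mu (fun x => (p n x)%:Cx * f x)) <= n.+1%:R^-1.
  apply: modulus_complete; first exact: cvg_harmonic.
  move=> m n; rewrite -RadonB//.
  have -> : (fun x => (p m x)%:Cx * f x - (p n x)%:Cx * f x) =
      fun x => (p m x * (1 - p n x))%:Cx * f x - (p n x * (1 - p m x))%:Cx * f x.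
    apply/funext => x; rewrite -!mulrBl -!rmorphB; congr (_%:Cx * _); lra.
  rewrite RadonB//; apply: le_trans (modulusD _ _) _; rewrite modulusN addrC.
  by apply: lerD; exact: part_le.
exists z => e e0.
have [n ne] : exists n : nat, n.+1%:R^-1 <= e.
  have /cvgrPdist_lt/(_ _ e0)[n _ /(_ n (leqnn n))] := @cvg_harmonic R.
  by rewrite /= sub0r normrN ger0_norm ?invr_ge0// => /ltW ne; exists n.
exists (fun x => (p n x)%:Cx * f x); split => //; last exact: le_trans (zu n) _.
apply: (@le_trans _ _ (upper_integral mu (fun x => (c * (\1_A x - p n x))%:E))).
  apply: upper_integral_ge => k kc hk; apply: ereal_inf_lbound; exists k => //.
  split => // x; apply: le_trans (hk x); rewrite lee_fin.
  by apply: modulus_truncB => //; exact: ltW.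
apply: le_trans (upper_integral_le _ _) _.
  by apply: lscrZ; [exact: ltW|exact: lscr_indicB].
by apply: le_trans (pI n) _; rewrite lee_fin.
Qed.

(** Once an integral exists, the default value 0 of [xget] is no longer an issue. All later
    estimates reach the values of [restrict_measure] through this comparison with mu on C_c(G). *)
Theorem restrict_approx mu A p f (b : R) : Radon_measure mu -> open A ->
  compact (closure A) -> Cc p -> (forall x, 0 <= p x <= \1_A x) -> Cc f -> 0 <= b ->
  (forall x, A x -> modulus (f x) <= b) ->
  ((modulus (restrict_measure mu A f - mu (fun x => (p x)%:Cx * f x)))%:E <=
   b%:E * upper_integral_lsc mu (fun x => (\1_A x - p x)%:E))%E.
Proof.
move=> muR oA cA pc pA fc b0 fb; apply: is_integral_trunc_dist => //.
have [z zP] := is_integral_trunc_ex muR oA cA fc fb.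
exact: (@xgetPex _ 0 _ (ex_intro _ z zP)).
Qed.

End Restriction.

(** * Slices of a convolution *)

Section Slice.
Context {R : realType} {G : topologicalZmodType}.
Hypothesis hausG : hausdorff_space G.
Hypothesis lcG : locally_compact [set: G].
Implicit Types (mu nu : functional R G) (A B C K U W : set G) (f g h : G -> Cplx R).

Lemma indic_shift t A x : \1_(shift_set t A) x = \1_A (x - t) :> R.
Proof. by rewrite shift_setE. Qed.

Lemma upper_integral_indic_le_variation mu A B : A `<=` B ->
  (upper_integral_lsc mu (fun x => (\1_A x)%:E) <= variation_set mu B)%E.
Proof.
move=> AB; apply: upper_integral_ge => k _ Bk; apply: upper_integral_lsc_mono => x.
apply: le_trans (Bk x); rewrite lee_fin !indicE.
by have [/set_mem/AB/mem_set->//|_] := boolP (x \in A); rewrite ler0n.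
Qed.

Lemma variation_set_le_norm_on mu K t :
  (variation_set mu (shift_set t K) <= norm_on K mu)%E.
Proof. by apply: ereal_sup_ubound; exists t. Qed.

Lemma norm_on_ge0 mu K : Radon_measure mu -> (0 <= norm_on K mu)%E.
Proof.
move=> muR; apply: le_trans (variation_set_le_norm_on mu K 0).
apply: le_trans (upper_integral_indic_le_variation _ (@sub0set _ _)).
by apply: upper_integral_lsc_ge0 => // y; rewrite lee_fin indicE ler0n.
Qed.

(** A cutoff p lies between 0 and 1, so p f is itself one of the functions h; the bound S passes to
    the restriction without any dependence on A. *)
Lemma restrict_le mu A f (b S : R) : Radon_measure mu -> open A ->
  compact (closure A) -> Cc f -> (forall x, modulus (f x) <= b) ->
  (forall h, Cc h -> (forall x, modulus (h x) <= modulus (f x)) ->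
    modulus (mu h) <= S) ->
  modulus (restrict_measure mu A f) <= S.
Proof.
move=> muR oA cA fc fb fS; apply/ler_addgt0Pr => e e0.
have b0 : 0 <= b by apply: le_trans (fb 0); exact: modulus_ge0.
have b1 : 0 < b + 1 by rewrite ltr_wpDl.
have [p [pc pA pI]] := approx_indic muR oA cA (divr_gt0 e0 b1).
have [pf pfr] : Cc (fun x => (p x)%:Cx * f x) /\ modulus (restrict_measure mu A f
    - mu (fun x => (p x)%:Cx * f x)) <= e.
  split; first by apply: CcMr => //; exact: pc.1.
  rewrite -lee_fin; apply: le_trans
    (restrict_approx hausG lcG muR oA cA pc pA fc b0 (fun x _ => fb x)) _.
  apply: le_trans (lee_wpmul2l _ pI) _; first by rewrite lee_fin.
  rewrite -EFinM lee_fin mulrA ler_pdivrMr//; nra.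
have : modulus (mu (fun x => (p x)%:Cx * f x)) <= S.
  apply: fS => // x; rewrite modulusM modulus_real; have /andP[p0 p1] := pA x.
  rewrite ger0_norm// ler_piMl ?modulus_ge0//.
  by apply: le_trans p1 _; rewrite indicE lern1 leq_b1.
have := modulusD (restrict_measure mu A f - mu (fun x => (p x)%:Cx * f x))
  (mu (fun x => (p x)%:Cx * f x)).
rewrite subrK; lra.
Qed.

(** Since f is bounded, one cutoff p replaces 1_B within e / 4 for all x at once. What is left is
    uniform convergence of f(x + .) to f(x0 + .) on the compact closure of B, obtained from joint
    continuity. *)
Lemma continuous_slice nu B f (b : R) : Radon_measure nu -> open B ->
  compact (closure B) -> Cc f -> (forall x, modulus (f x) <= b) ->
  continuous (fun x => restrict_measure nu B (fun y => f (x + y)) : Cplx R).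
Proof.
move=> nuR oB cB fc fb x0; apply/cvg_modulusP => e e0.
have b0 : 0 <= b by apply: le_trans (fb 0); exact: modulus_ge0.
have b1 : 0 < 4 * (b + 1) by lra.
have [p [pc pB pI]] := approx_indic nuR oB cB (divr_gt0 e0 b1).
have sliceC x : Cc (fun y => f (x + y)) by exact: Cc_shiftl.
have pf x : modulus (restrict_measure nu B (fun y => f (x + y))
    - nu (fun y => (p y)%:Cx * f (x + y))) <= e / 4.
  rewrite -lee_fin.
  apply: le_trans (restrict_approx hausG lcG nuR oB cB pc pB (sliceC x) b0 _) _.
    by move=> y _.
  apply: le_trans (lee_wpmul2l _ pI) _; first by rewrite lee_fin.
  rewrite -EFinM lee_fin mulrA ler_pdivrMr// -mulrA mulrC mulrA; nra.
have [_ _ /(_ _ cB)[M nuM]] := nuR.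
have M1 : 0 < `|M| + 1 by rewrite ltr_wpDl.
pose d := e / 4 / (`|M| + 1).
have d0 : 0 < d by rewrite !divr_gt0.
have fd : \forall x \near x0, closure B `<=` [set y | modulus (f (x0 + y) - f (x + y)) < d].
  move/compact_near_coveringP : cB => cB.
  apply: (cB _ _ (fun x y => modulus (f (x0 + y) - f (x + y)) < d)) => y _.
  have d2 : 0 < d / 2 by lra.
  have fxy : {for (y, x0), continuous (fun z : G * G => f (z.2 + z.1))}.
    apply: (@continuous_comp _ _ _ (fun z : G * G => z.2 + z.1) f).
      apply: (@continuous_comp _ _ _ (fun z : G * G => (z.2, z.1)) (fun z : G * G => z.1 + z.2)).
        by apply: cvg_pair; [exact: cvg_snd|exact: cvg_fst].
      exact: add_continuous.
    exact: fc.1.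
  have fy : {for y, continuous (fun y' => f (x0 + y'))}.
    apply: (@continuous_comp _ _ _ (fun y' => x0 + y') f).
      exact: continuousDl.
    exact: fc.1.
  move/cvg_modulusP : fxy => /(_ _ d2)[[P Q] /= [Py Qx] PQ].
  move/cvg_modulusP : fy => /(_ _ d2) Ty.
  exists (P `&` [set y' | modulus (f (x0 + y) - f (x0 + y')) < d / 2], Q).
    by split => //; exact: filterI.
  move=> [y' x] /= [[Py' Ty'] Qx'].
  have := PQ (y', x) (conj Py' Qx') => /=.
  have := modulus_triangle (f (x0 + y)) (f (x0 + y')) (f (x + y')).
  rewrite [modulus (f (x0 + y') - f (x0 + y))]modulusB; lra.
move: fd; apply: filterS => x fd.
have : modulus (nu (fun y => (p y)%:Cx * f (x0 + y))
    - nu (fun y => (p y)%:Cx * f (x + y))) <= e / 4.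
  have pC z : Cc (fun y => (p y)%:Cx * f (z + y)) by apply: CcMr => //; exact: pc.1.
  rewrite -RadonB//; apply: (@le_trans _ _ (M * d)); last first.
    rewrite /d mulrA ler_pdivrMr// mulrC ler_pM2l ?divr_gt0//.
    by have := ler_norm M; lra.
  have pout y : ~ B y -> p y = 0.
    move=> nBy; have := pB y; rewrite indicE memNset//= => py.
    by apply/eqP; rewrite eq_le andbC.
  apply: nuM => [|y nBy|y]; first exact: CcB.
    rewrite pout; first by rewrite !mul0r subr0.
    by move=> /subset_closure.
  rewrite -mulrBr modulusM modulus_real; have /andP[p0 p1] := pB y.
  rewrite ger0_norm//; have [By|nBy] := pselect (B y); last first.
    by rewrite pout// mul0r ltW.
  have := fd _ (subset_closure By); rewrite /= => fy.
  apply: le_trans (ltW fy); rewrite ler_piMl ?modulus_ge0//.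
  by apply: le_trans p1 _; rewrite indicE lern1 leq_b1.
have := pf x0; have := pf x; rewrite modulusB.
set u := restrict_measure _ _ _; set v := restrict_measure _ _ _.
set u' := nu _; set v' := nu _ => h1 h2 h3.
have := modulus_triangle v' v u; have := modulus_triangle u' v' u; lra.
Unshelve. all: by end_near. Qed.

Lemma Cc_slice nu B f (b : R) : Radon_measure nu -> open B ->
  compact (closure B) -> Cc f -> (forall x, modulus (f x) <= b) ->
  Cc (fun x => restrict_measure nu B (fun y => f (x + y)) : Cplx R).
Proof.
move=> nuR oB cB fc fb; have [C [cC clC fC]] := Cc_support fc.
have cD : compact (add_set C (opp_set (closure B))).
  by apply: compact_add => //; exact: compact_opp.
apply: (compact_Cc _ cD) => //; first exact: continuous_slice fb.
  exact: compact_closed.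
move=> x nDx.
have sliceC : Cc (fun y => f (x + y)) by exact: Cc_shiftl.
have fx0 y : B y -> modulus (f (x + y)) <= 0.
  move=> By; rewrite fC ?modulus0// => Cxy; apply: nDx.
  exists (x + y) => //; exists (- y); last by rewrite addrK.
  by exists y => //; exact: subset_closure.
(* As f(x + .) vanishes on B, the approximation holds with bound 0 and is an equality for any
   cutoff; the tolerance 1 is arbitrary. *)
have [p [pc pB _]] := approx_indic nuR oB cB ltr01.
have := restrict_approx hausG lcG nuR oB cB pc pB sliceC (lexx 0) fx0.
rewrite mul0e lee_fin => r0; apply: modulus_eq0; apply/eqP.
rewrite eq_le modulus_ge0 andbT -[X in modulus X]subr0; apply: le_trans r0.
rewrite le_eqVlt; apply/orP; left; apply/eqP; congr (modulus (_ - _)).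
rewrite -(Radon0 nuR); congr nu; apply/funext => y.
have [By|nBy] := pselect (B y).
  suff -> : f (x + y) = 0 by rewrite mulr0.
  by apply: modulus_eq0; apply/eqP; rewrite eq_le fx0// modulus_ge0.
suff -> : p y = 0 by rewrite mul0r.
have := pB y; rewrite indicE memNset//= => py.
by apply/eqP; rewrite eq_le andbC.
Qed.

(** As a function of y, f(x + y) lives on the translate s - x + U, inside a translate of L. The
    resulting bound is uniform in x, s and B, hence along B = -A_n. *)
Lemma slice_le nu B U L s f x : Radon_measure nu -> open B ->
  compact (closure B) -> U `<=` L -> (norm_on L nu < +oo)%E -> Cc f ->
  (forall y, modulus (f y) <= \1_(shift_set s U) y) ->
  modulus (restrict_measure nu B (fun y => f (x + y))) <= fine (norm_on L nu).
Proof.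
move=> nuR oB cB UL Loo fc fU.
have sliceC : Cc (fun y => f (x + y)) by exact: Cc_shiftl.
have f1 y : modulus (f (x + y)) <= 1.
  by apply: le_trans (fU _) _; rewrite indicE lern1 leq_b1.
apply: (restrict_le nuR oB cB sliceC f1) => h hc hf.
rewrite -lee_fin fineK; last by rewrite ge0_fin_numE//; exact: norm_on_ge0.
apply: le_trans (variation_set_le_norm_on nu L (s - x)).
apply: (@le_trans _ _ (upper_integral_lsc nu (fun y => (\1_(shift_set (s - x) U) y)%:E))).
  apply: le_upper_integral_lsc => // y; rewrite lee_fin.
  apply: le_trans (hf y) _; apply: le_trans (fU _) _.
  by rewrite !indic_shift opprB addrA [y + x]addrC.
by apply: upper_integral_indic_le_variation => _ [y /UL Ly <-]; exists y.
Qed.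

End Slice.

(** * Haar measure and packings *)

(** Compactness as an induction principle. The sets with property P form an ideal, hence a family
    directed by inclusion, and near covering along the filter of its large members yields one that
    contains K. *)
Lemma compact_property {T : topologicalType} (P : set T -> Prop) (K : set T) :
  P set0 -> (forall A B, P A -> P B -> P (A `|` B)) ->
  (forall A B, A `<=` B -> P B -> P A) ->
  (forall x : T, exists2 V, nbhs x V & P V) -> compact K -> P K.
Proof.
move=> P0 PU Psub Ploc /compact_near_coveringP cK.
pose F := filter_from P (fun A => [set B | P B /\ A `<=` B]).
have FF : ProperFilter F.
  apply: filter_from_proper; last by move=> A PA; exists A; split.
  apply: filter_from_filter; first by exists set0.
  move=> A B PA PB; exists (A `|` B); first exact: PU.
  by move=> C [PC]; rewrite subUset => -[AC BC].
have FP : F P by exists set0 => //; move=> B [].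
suff /(filterI FP)/filter_ex[A [PA KA]] : F [set A | K `<=` A] by exact: Psub KA PA.
apply: (cK _ F (fun A x => A x)) => x _.
have [V Vx PV] := Ploc x.
exists (V, [set B | P B /\ V `<=` B]) => /=; first by split => //; exists V.
by move=> [y B] /= [Vy [_]]; apply.
Qed.

Section HaarPacking.
Context {R : realType} {G : topologicalZmodType}.
Variable haar : {measure set (borelType G) -> \bar R}.
Hypothesis haarP : is_Haar haar.
Implicit Types (A B C K W S : set G).

Lemma borel_open A : open A -> measurable (A : set (borelType G)).
Proof. by move=> oA; apply: sub_sigma_algebra. Qed.

Lemma borel_closed A : closed A -> measurable (A : set (borelType G)).
Proof.
move=> cA; rewrite -(setCK A); apply: measurableC; apply: borel_open.
exact: closed_openC.
Qed.

Lemma haar_shift t A : open A -> haar (shift_set t A) = haar A.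
Proof. by case: haarP => _ h _ oA; apply: h; exact: borel_open. Qed.

(** Finitely many translates of a null W would cover the compact closure of A and make A null.
    Nullity is phrased through open supersets, so that only measures of open sets are compared. *)
Lemma haar_gt0 W A : open W -> W !=set0 -> open A -> compact (closure A) ->
  (0 < haar A)%E -> (0 < haar W)%E.
Proof.
move=> oW [w Ww] oA cA; apply: contraTT; rewrite -!leNgt => W0.
have {}W0 : haar W = 0%E by apply/eqP; rewrite eq_le W0 measure_ge0.
pose null B := exists2 D, open D /\ B `<=` D & haar D = 0%E.
have [D [oD AD] D0] : null (closure A).
  apply: compact_property cA.
  - by exists set0; [split => //; exact: open0|exact: measure0].
  - move=> B C [D [oD BD] D0] [E [oE CE] E0]; exists (D `|` E).
      by split; [exact: openU|exact: setUSS].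
    apply/eqP; rewrite eq_le measure_ge0 andbT.
    apply: le_trans (measureU2 _ _ _) _; [exact: borel_open|exact: borel_open|].
    rewrite -[0%E]adde0; apply: leeD; rewrite le_eqVlt; apply/predU1P; left; [exact: D0|exact: E0].
  - by move=> B C BC [D [oD CD] D0]; exists D => //; split => //; exact: subset_trans CD.
  - move=> x; exists (shift_set (x - w) W).
      apply: open_nbhs_nbhs; split; first exact: open_shift.
      by rewrite shift_setE /= opprB addrC subrK.
    exists (shift_set (x - w) W); last by rewrite haar_shift.
    by split => //; exact: open_shift.
rewrite -D0; apply: le_measure; rewrite ?inE; [exact: borel_open|exact: borel_open|].
by apply: subset_trans AD; exact: subset_closure.
Qed.

Definition shifts (s : seq G) W : set G := [set x | exists2 y, y \in s & W (x - y)].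

Lemma shifts_cons y s W : shifts (y :: s) W = shift_set y W `|` shifts s W.
Proof.
rewrite shift_setE; apply/seteqP; split=> x.
  by move=> [z]; rewrite inE => /predU1P[->|zs] Wxz; [left|right; exists z].
move=> [Wxy|[z zs Wxz]]; first by exists y; rewrite ?mem_head.
by exists z => //; rewrite inE zs orbT.
Qed.

Lemma open_shifts s W : open W -> open (shifts s W).
Proof.
move=> oW; elim: s => [|y s IH].
  suff -> : shifts [::] W = set0 by exact: open0.
  by apply/seteqP; split => // x [].
by rewrite shifts_cons; apply: openU => //; exact: open_shift.
Qed.

(* A maximal family of disjoint translates of W centred in B. *)
Lemma packing W B S : open W -> (0 < haar W < +oo)%E ->
  measurable (S : set (borelType G)) -> (haar S < +oo)%E -> add_set B W `<=` S ->
  exists2 s : seq G, (size s)%:R * fine (haar W) <= fine (haar S) &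
    B `<=` shifts s (add_set W (opp_set W)).
Proof.
move=> oW /andP[W0 Woo] mS Soo BWS.
(* Disjointness is recorded through the measure of the union, n |W| for n disjoint translates;
   comparison with S bounds n, so a largest n exists. *)
pose P n := exists s : seq G, [/\ size s = n, forall y, y \in s -> B y
  & haar (shifts s W) = (n%:R * fine (haar W))%:E].
have hW : haar W = (fine (haar W))%:E by rewrite fineK// gt0_fin_numE.
have hS : haar S = (fine (haar S))%:E by rewrite fineK// ge0_fin_numE.
have w0 : 0 < fine (haar W) by rewrite -lte_fin -hW.
have PS n : P n -> n%:R * fine (haar W) <= fine (haar S).
  move=> [s [_ sB sW]]; rewrite -lee_fin -hS -sW; apply: le_measure.
  - by rewrite inE; apply: borel_open; exact: open_shifts.
  - by rewrite inE.
  - move=> x [y ys Wxy]; apply: BWS; exists y; first exact: sB.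
    by exists (x - y); rewrite // addrC subrK.
have exP : exists n, `[< P n >].
  exists 0; apply/asboolP; exists [::]; split => //.
  suff -> : shifts [::] W = set0 by rewrite measure0 mul0r.
  by apply/seteqP; split => // x [].
have bndP n : `[< P n >] -> (n <= Num.bound (fine (haar S) / fine (haar W)))%N.
  move=> /asboolP/PS; rewrite -ler_pdivlMr// => nS; rewrite -(ler_nat R) ltW//.
  apply: le_lt_trans nS _; apply: archi_boundP.
  by rewrite divr_ge0 ?fine_ge0.
case: (ex_maxnP exP bndP) => n /asboolP[s [sn sB sW]] nmax.
exists s; first by rewrite sn; apply: PS; exists s.
(* A point x of B outside every y + W - W would add a translate disjoint from the family: a common
   point z of x + W and y + W means x = y + (z - y) - (z - x). *)
move=> x Bx; apply: contrapT => nx.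
suff /asboolP/nmax : P n.+1 by rewrite ltnn.
exists (x :: s); split; first by rewrite /= sn.
  by move=> y; rewrite inE => /predU1P[->|/sB].
rewrite shifts_cons measureU; last first.
- apply/seteqP; split => // z []; rewrite shift_setE /= => Wzx [y ys Wzy]; apply: nx.
  exists y => //; exists (z - y) => //; exists (- (z - x)); first by exists (z - x).
  by rewrite opprB addrC addrA subrK.
- by apply: borel_open; exact: open_shifts.
- by apply: borel_open; exact: open_shift.
rewrite -[n.+1]add1n natrD mulrDl mul1r EFinD; congr (_ + _)%E => //.
exact: etrans (haar_shift _ oW) hW.
Qed.

Hypothesis hausG : hausdorff_space G.

(** * Packings and van Hove boundaries *)

Lemma closure_add_subset A K : compact K -> compact (closure A) ->
  closure (add_set A K) `<=` add_set (closure A) K.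
Proof.
move=> cK cA; apply: closure_sub_closed.
  by apply: compact_closed => //; exact: compact_add.
by apply: add_subset => //; exact: subset_closure.
Qed.

Lemma van_Hove_boundary_measurable K A : open A -> compact K ->
  measurable (van_Hove_boundary K A : set (borelType G)).
Proof.
move=> oA cK; apply: measurableU.
  apply: measurableD; first by apply: borel_closed; exact: closed_closure.
  exact: borel_open.
apply: measurableI; last by apply: borel_closed; exact: closed_closure.
apply: borel_closed; apply: closed_add_compact; first exact: open_closedC.
exact: compact_opp.
Qed.

Lemma haar_compact_lty K B : compact K -> B `<=` K ->
  measurable (B : set (borelType G)) -> (haar B < +oo)%E.
Proof.
move=> cK BK mB; case: haarP => /(_ _ cK) + _ _; apply: le_lt_trans.
apply: le_measure; rewrite ?inE//; apply: borel_closed; exact: compact_closed.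
Qed.

Lemma van_Hove_boundary_lty K A : open A -> compact (closure A) -> compact K ->
  (haar (van_Hove_boundary K A) < +oo)%E.
Proof.
move=> oA cA cK; apply: (@haar_compact_lty (add_set (closure A) K `|` closure A)).
- by apply: compactU => //; exact: compact_add.
- by move=> x [[/closure_add_subset h _]|[_]]; [left; exact: h|right].
- exact: van_Hove_boundary_measurable.
Qed.

Lemma fine_haar_boundary_le K A : open A -> compact (closure A) -> compact K ->
  fine (haar (A `|` van_Hove_boundary K A)) <=
  fine (haar A) + fine (haar (van_Hove_boundary K A)).
Proof.
move=> oA cA cK; have Aoo : (haar A < +oo)%E.
  apply: haar_compact_lty cA _ _; first exact: subset_closure.
  exact: borel_open.
have Boo := van_Hove_boundary_lty oA cA cK.
rewrite -fineD ?ge0_fin_numE//.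
have := measureU2 haar (borel_open oA) (van_Hove_boundary_measurable oA cK).
move=> h.
have ABoo : (haar A + haar (van_Hove_boundary K A) < +oo)%E by exact: lte_add_pinfty.
apply: fine_le => //; rewrite ge0_fin_numE ?adde_ge0//; exact: le_lt_trans h ABoo.
Qed.

(** Translates of W centred in A stay in A + W, and the part of A + W outside A belongs to the
    boundary, so the packing takes place in the union of A and its boundary. *)
Lemma packing_set W A : open W -> compact (closure W) -> (0 < haar W)%E ->
  open A -> compact (closure A) ->
  exists2 s : seq G,
    (size s)%:R * fine (haar W) <=
      fine (haar A) + fine (haar (van_Hove_boundary (closure W) A)) &
    A `<=` shifts s (add_set W (opp_set W)).
Proof.
move=> oW cW W0 oA cA.
have Woo : (haar W < +oo)%E.
  apply: haar_compact_lty cW _ _; first exact: subset_closure.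
  exact: borel_open.
have [||||s sle sA] := @packing W A (A `|` van_Hove_boundary (closure W) A) oW.
- by rewrite W0.
- by apply: measurableU; [exact: borel_open|exact: van_Hove_boundary_measurable].
- apply: le_lt_trans (measureU2 _ _ _) _.
  + exact: borel_open.
  + exact: van_Hove_boundary_measurable.
  + apply: lte_add_pinfty; last exact: van_Hove_boundary_lty.
    apply: haar_compact_lty cA _ _; first exact: subset_closure.
    exact: borel_open.
- move=> x AWx; have [Ax|nAx] := pselect (A x); [by left|right; left].
  split => //; apply: subset_closure; apply: add_subset AWx => //.
  exact: subset_closure.
- by exists s => //; apply: le_trans sle _; exact: fine_haar_boundary_le.
Qed.

(** If exactly one of x and x + t is in A, then x + w is in the boundary for every w in W: one of
    the two points is on the other side of A from x + w, and the displacement, with the sign that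
    the definition of the boundary asks for, is w, -w, w - t or t - w. K is built to contain these
    four; -w and t - w call on the symmetry of W. *)
Lemma packing_symdiff W A t : open W -> opp_set W `<=` W -> compact (closure W) ->
  (0 < haar W)%E -> open A -> compact (closure A) ->
  let K := closure W `|` (shift_set t (closure W) `|` shift_set (- t) (closure W)) in
  exists2 s : seq G,
    (size s)%:R * fine (haar W) <= fine (haar (van_Hove_boundary K A)) &
    forall x, (A x <-> ~ A (x + t)) -> shifts s (add_set W (opp_set W)) x.
Proof.
move=> oW symW cW W0 oA cA K.
have cK : compact K by apply: compactU => //; apply: compactU; exact: compact_shift.
have Woo : (haar W < +oo)%E.
  apply: haar_compact_lty cW _ _; first exact: subset_closure.
  exact: borel_open.
have WN w : W w -> W (- w) by move=> Ww; apply: symW; exists w.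
have [||||s sle sA] := @packing W [set x | A x <-> ~ A (x + t)] (van_Hove_boundary K A) oW.
- by rewrite W0.
- exact: van_Hove_boundary_measurable.
- exact: van_Hove_boundary_lty.
- move=> _ [x /= xA [w Ww <-]].
  have out y k : A y -> K k -> y + k = x + w -> ~ A (x + w) -> van_Hove_boundary K A (x + w).
    move=> Ay Kk yk nA; left; split => //; rewrite -yk; apply: subset_closure.
    by exists y => //; exists k.
  have inn y k : ~ A y -> K k -> y - k = x + w -> A (x + w) -> van_Hove_boundary K A (x + w).
    move=> nAy Kk yk Axw; right; split; last exact: subset_closure.
    by rewrite -yk; exists y => //; exists (- k) => //; exists k.
  have K1 : K w by left; exact: subset_closure.
  have K1' : K (- w) by left; apply: subset_closure; exact: WN.
  have K2 : K (t - w).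
    by right; left; exists (- w) => //; apply: subset_closure; exact: WN.
  have K3 : K (w - t).
    by right; right; exists w; [exact: subset_closure|rewrite addrC].
  have e1 : x - (- w) = x + w by rewrite opprK.
  have e2 : x + t - (t - w) = x + w by rewrite opprB addrACA subrr addr0.
  have e3 : x + t + (w - t) = x + w by rewrite addrACA subrr addr0.
  have [Axw|nAxw] := pselect (A (x + w)); have [Ax|nAx] := pselect (A x).
  + exact: inn (xA.1 Ax) K2 e2 Axw.
  + exact: inn nAx K1' e1 Axw.
  + exact: out Ax K1 erefl nAxw.
  + by apply: out _ K3 e3 nAxw; apply: contrapT => /xA.
- by exists s.
Qed.

End HaarPacking.

(** * The basic estimate *)

Section Estimate.
Context {R : realType} {G : topologicalZmodType}.
Hypothesis hausG : hausdorff_space G.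
Hypothesis lcG : locally_compact [set: G].
Implicit Types (mu nu : functional R G) (A B C K L U V W : set G).
Implicit Types (f g h : G -> Cplx R) (s : seq G).

Lemma Radon_diff t mu : Radon_measure mu ->
  Radon_measure (fun f => mu f - translate_measure t mu f).
Proof.
move=> [muD muZ muK]; split.
- move=> f g fc gc; rewrite /translate_measure /translate_fun.
  rewrite muD// muD//; [|exact: Cc_shift|exact: Cc_shift].
  by rewrite opprD addrACA.
- move=> c f fc; rewrite /translate_measure /translate_fun.
  by rewrite muZ// muZ; [rewrite mulrBr|exact: Cc_shift].
- move=> K cK; have [M muM] := muK _ cK.
  have [N muN] := muK _ (@compact_shift G (- t) K cK).
  exists (M + N) => f b fc fK fb; apply: le_trans (modulusD _ _) _.
  rewrite modulusN mulrDl lerD//; first exact: muM.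
  apply: muN => [|x nx|x]; [exact: Cc_shift| |exact: fb].
  apply: fK => Kx; apply: nx; rewrite shift_setE /= opprK.
  by rewrite opprK in Kx.
Qed.

(** The covering is counted with multiplicity instead of through the indicator of the union: a sum
    is bounded term by term by subadditivity, and it is at least 1 on the covered set. *)
Definition mult V s (x : G) : R := \sum_(y <- s) \1_(shift_set y V) x.

Lemma mult_ge0 V s x : 0 <= mult V s x.
Proof. by apply: sumr_ge0 => y _; rewrite indicE ler0n. Qed.

Lemma mult_ge1 V s x : shifts s V x -> 1 <= mult V s x.
Proof.
move=> [y ys Vxy]; rewrite /mult (big_rem y)//= indic_shift indicE mem_set//.
by rewrite lerDl; exact: mult_ge0.
Qed.

Lemma lscr_mult V s : open V -> lscr (mult V s).
Proof.
move=> oV; elim: s => [|y s IH].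
  have -> : mult V [::] = fun=> 0 by apply/funext => x; rewrite /mult big_nil.
  by apply: lscr_continuous => x; exact: cvg_cst.
have -> : mult V (y :: s) = fun x => \1_(shift_set y V) x + mult V s x.
  by apply/funext => x; rewrite /mult big_cons.
by apply: lscrD => //; apply: lscr_indic; exact: open_shift.
Qed.

(** Each term costs at most one norm, as y + V = (y - k0) + (k0 + V) lies in a translate of K. This
    serves both mu and mu - tau_t mu, each with its own c. *)
Lemma upper_integral_mult mu V K k0 s (c : R) : Radon_measure mu -> open V ->
  shift_set k0 V `<=` K -> (norm_on K mu <= c%:E)%E ->
  (upper_integral_lsc mu (fun x => (mult V s x)%:E) <= ((size s)%:R * c)%:E)%E.
Proof.
move=> muR oV VK Kc; elim: s => [|y s IH].
  rewrite mul0r; apply: upper_integral_lsc_le => g gc g0.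
  have -> : g = fun=> 0.
    apply/funext => x; apply: modulus_eq0; apply/eqP.
    by rewrite eq_le modulus_ge0 andbT -lee_fin (le_trans (g0 x))// /mult big_nil.
  by rewrite Radon0// modulus0.
rewrite -[size (y :: s)]add1n natrD mulrDl mul1r EFinD.
have -> : (fun x => (mult V (y :: s) x)%:E) =
    (fun x => (\1_(shift_set y V) x)%:E + (mult V s x)%:E)%E.
  by apply/funext => x; rewrite /mult big_cons EFinD.
apply: le_trans (upper_integral_lscD hausG lcG muR _ _ _ _) _.
- by move=> x; rewrite lee_fin indicE ler0n.
- by move=> x; rewrite lee_fin mult_ge0.
- by apply: lscr_indic; exact: open_shift.
- exact: lscr_mult.
apply: leeD => //; apply: le_trans Kc.
apply: le_trans (variation_set_le_norm_on mu K (y - k0)).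
apply: upper_integral_indic_le_variation => _ [v Vv <-].
exists (k0 + v); first by apply: VK; exists v.
by rewrite addrA subrK.
Qed.

(** One cutoff p serves both restrictions: mu(p f) minus mu((p f)(. + t)) is exactly (mu - tau_t
    mu)(p f), and replacing p(. + t) by p is an error concentrated where A and A - t differ. The
    translates in s1 pay for the first with c', those in s2 for the second with c. *)
Lemma restrict_shift_le mu A f t (b : R) V K k0 s1 s2 (c c' : R) :
  Radon_measure mu -> open A -> compact (closure A) -> Cc f -> 0 <= b ->
  (forall x, modulus (f x) <= b) -> open V -> shift_set k0 V `<=` K ->
  A `<=` shifts s1 V -> (forall x, (A x <-> ~ A (x + t)) -> shifts s2 V x) ->
  (norm_on K mu <= c%:E)%E ->
  (norm_on K (fun f => mu f - translate_measure t mu f)%R <= c'%:E)%E ->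
  modulus (restrict_measure mu A f - restrict_measure mu A (fun x => f (x + t)))
    <= b * ((size s1)%:R * c' + (size s2)%:R * c).
Proof.
move=> muR oA cA fc b0 fb oV VK As1 As2 Kc Kc'.
apply/ler_addgt0Pr => e e0.
(* Four errors of size b d occur: one for each of the two restrictions, and two in comparing p with
   p(. + t). *)
pose d := e / (4 * (b + 1)).
have d0 : 0 < d by rewrite divr_gt0//; lra.
have bd : b * d * 4 <= e.
  rewrite /d mulrA mulrAC ler_pdivrMr; last lra.
  nra.
have oAt : open (shift_set (- t) A) by exact: open_shift.
have cAt : compact (closure (shift_set (- t) A)).
  apply: (compact_closure_sub hausG (compact_shift (t := - t) cA)).
  by move=> _ [x Ax <-]; exists x => //; exact: subset_closure.
have [p1 [p1c p1A p1I]] := approx_indic muR oA cA d0.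
have [p2 [p2c p2A p2I]] := approx_indic muR oAt cAt d0.
(* p approximates 1_A for mu, and p(. + t) approximates the indicator of A - t
   for mu as well. *)
pose p x := Num.max (p1 x) (p2 (x - t)).
have pC : Cc p by apply: Cc_max => //; exact: Cc_shift.
have ptC : Cc (fun x => p (x + t)) by exact: Cc_shift.
have ftC : Cc (fun x => f (x + t)) by exact: Cc_shift.
have pA x : 0 <= p x <= \1_A x.
  rewrite /p le_max ge_max; have := p2A (x - t); rewrite indic_shift opprK subrK.
  by have /andP[-> ->] := p1A x => /andP[_ ->].
have ptA x : 0 <= p (x + t) <= \1_(shift_set (- t) A) x.
  by rewrite indic_shift opprK.
have pI : (upper_integral_lsc mu (fun x => (\1_A x - p x)%:E) <= d%:E)%E.
  apply: le_trans p1I; apply: upper_integral_lsc_mono => x.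
  by rewrite lee_fin lerD2l lerN2 /p le_max lexx.
have ptI : (upper_integral_lsc mu (fun x => (\1_(shift_set (- t) A) x - p (x + t))%:E) <= d%:E)%E.
  apply: le_trans p2I; apply: upper_integral_lsc_mono => x.
  by rewrite lee_fin lerD2l lerN2 /p addrK le_max lexx orbT.
have approx g : Cc g -> (forall x, modulus (g x) <= b) ->
    modulus (restrict_measure mu A g - mu (fun x => (p x)%:Cx * g x)) <= b * d.
  move=> gc gb; rewrite -lee_fin.
  apply: le_trans (restrict_approx hausG lcG muR oA cA pC pA gc b0 (fun x _ => gb x)) _.
  by rewrite EFinM lee_wpmul2l.
have h1 := approx _ fc fb.
have h2 := approx _ ftC (fun x => fb (x + t)).
have pfC : Cc (fun x => (p x)%:Cx * f x) by apply: CcMr => //; exact: pC.1.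
have pftC : Cc (fun x => (p x)%:Cx * f (x + t)) by apply: CcMr => //; exact: pC.1.
have ptftC : Cc (fun x => (p (x + t))%:Cx * f (x + t)).
  by apply: CcMr => //; exact: ptC.1.
have h3 : modulus (mu (fun x => (p x)%:Cx * f x) - mu (fun x => (p (x + t))%:Cx * f (x + t)))
    <= b * ((size s1)%:R * c').
  rewrite -lee_fin EFinM.
  apply: le_trans (lee_wpmul2l _ (upper_integral_mult s1 (Radon_diff t muR) oV VK Kc')); last first.
    by rewrite lee_fin.
  apply: le_trans (upper_integral_lscZ _ (Radon_diff t muR) b0).
  have -> : mu (fun x => (p (x + t))%:Cx * f (x + t)) =
      translate_measure t mu (fun x => (p x)%:Cx * f x).
    by congr mu; apply/funext => x; rewrite /translate_fun opprK.
  apply: (le_upper_integral_lsc (fun f => mu f - translate_measure t mu f) pfC).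
  move=> x; rewrite -EFinM lee_fin modulusM modulus_real mulrC.
  have /andP[px0 pxA] := pA x; rewrite ger0_norm// ler_pM ?modulus_ge0//.
  apply: le_trans pxA _; rewrite indicE.
  by case: (boolP (x \in A)) => [/set_mem/As1/mult_ge1//|_]; exact: mult_ge0.
(* p(x + t) - p(x) differs from 1_(A - t) - 1_A by at most the sum of the two approximation defects,
   and the latter is nonzero only on the symmetric difference, which s2 covers. *)
have h4 : modulus (mu (fun x => (p (x + t))%:Cx * f (x + t)) - mu (fun x => (p x)%:Cx * f (x + t)))
    <= b * (d + d + (size s2)%:R * c).
  rewrite -RadonB// -lee_fin.
  pose k1 x := \1_A x - p x; pose k2 x := \1_(shift_set (- t) A) x - p (x + t).
  have k10 x : 0 <= k1 x by rewrite subr_ge0; case/andP: (pA x).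
  have k20 x : 0 <= k2 x by rewrite subr_ge0; case/andP: (ptA x).
  have k1c : lscr k1 by exact: lscr_indicB.
  have k2c : lscr k2 by exact: lscr_indicB.
  have k12c : lscr (fun x => k1 x + k2 x) by exact: lscrD.
  rewrite EFinM; apply: (@le_trans _ _ (b%:E * upper_integral_lsc mu
      (fun x => (k1 x + k2 x)%:E + (mult V s2 x)%:E))%E); last first.
    apply: lee_wpmul2l; first by rewrite lee_fin.
    apply: le_trans (upper_integral_lscD hausG lcG muR _ _ k12c (lscr_mult oV)) _.
    - by move=> x; rewrite lee_fin addr_ge0.
    - by move=> x; rewrite lee_fin mult_ge0.
    rewrite EFinD; apply: leeD; last exact: upper_integral_mult muR oV VK Kc.
    under [X in upper_integral_lsc _ X]eq_fun do rewrite EFinD.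
    apply: le_trans (upper_integral_lscD hausG lcG muR _ _ k1c k2c) _ => //.
    by rewrite EFinD; exact: leeD.
  apply: le_trans (upper_integral_lscZ _ muR b0).
  apply: le_upper_integral_lsc; first exact: CcB.
  move=> x; rewrite -EFinD -EFinM lee_fin -mulrBl -rmorphB modulusM modulus_real mulrC.
  apply: ler_pM => //; first exact: modulus_ge0.
  have := pA x; have := ptA x; have := mult_ge0 V s2 x.
  have : (A x <-> ~ A (x + t)) -> 1 <= mult V s2 x by move=> /As2/mult_ge1.
  rewrite /k1 /k2 indic_shift opprK !indicE ler_norml.
  have [Ax|nAx] := pselect (A x); have [Axt|nAxt] := pselect (A (x + t)).
  - rewrite (mem_set Ax) (mem_set Axt) /= => _; lra.
  - have /[swap]/[apply] : A x <-> ~ A (x + t) by [].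
    rewrite (mem_set Ax) (memNset nAxt) /=; lra.
  - have /[swap]/[apply] : A x <-> ~ A (x + t) by split.
    rewrite (memNset nAx) (mem_set Axt) /=; lra.
  - rewrite (memNset nAx) (memNset nAxt) /= => _; lra.
have := modulus_triangle (mu (fun x => (p x)%:Cx * f x)) (restrict_measure mu A f)
  (restrict_measure mu A (fun x => f (x + t))).
have := modulus_triangle (mu (fun x => (p (x + t))%:Cx * f (x + t))) (mu (fun x => (p x)%:Cx * f x))
  (restrict_measure mu A (fun x => f (x + t))).
have := modulus_triangle (mu (fun x => (p x)%:Cx * f (x + t))) (mu (fun x => (p (x + t))%:Cx * f (x + t)))
  (restrict_measure mu A (fun x => f (x + t))).
rewrite [modulus (mu (fun x => (p x)%:Cx * f (x + t)) - restrict_measure _ _ _)]modulusB.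
move: h1 h2 h3 h4 bd; rewrite !mulrDr; lra.
Qed.

End Estimate.

(** * Eberlein convolutions *)

Section Eberlein.
Context {R : realType} {G : topologicalZmodType}.
Hypothesis hausG : hausdorff_space G.
Hypothesis lcG : locally_compact [set: G].
Implicit Types (mu nu sigma : functional R G) (A B C K L U V W : set G).

(** Continuity of k0 + x - y at the origin, followed by intersection with the opposite set. It is W
    - W that must fit into K up to translation, since the packing covers only by these enlarged
    sets. *)
Lemma symmetric_nbhs K : interior K !=set0 -> exists W, [/\ open W, W 0,
  opp_set W `<=` W, compact (closure W)
  & exists k0, shift_set k0 (add_set W (opp_set W)) `<=` K].
Proof.
move=> [k0 Kk0].
have sc : {for (0, 0), continuous (fun z : G * G => k0 + (z.1 - z.2))}.
  apply: (@continuous_comp _ _ _ (fun z : G * G => z.1 - z.2) (fun x => k0 + x)).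
    exact: sub_continuous.
  exact: continuousDl.
have [[P Q] /= [P0 Q0] PQ] : nbhs ((0, 0) : G * G) [set z | K (k0 + (z.1 - z.2))].
  by apply: sc; rewrite /= subr0 addr0.
have [W0 [oW0 W00 W0PQ cW0]] := locally_compact_nbhs lcG (filterI P0 Q0).
exists (W0 `&` opp_set W0); split.
- by apply: openI => //; exact: open_opp.
- by split => //; rewrite opp_setE /= oppr0.
- move=> _ [w [Ww nWw] <-]; split; last by exists w.
  by move: nWw; rewrite opp_setE.
- apply: (subclosed_compact _ cW0); first exact: closed_closure.
  by apply: closureS => x [].
- exists k0 => _ [_ [w [Ww _] [_ [w' [Ww' _] <-] <-]] <-].
  apply: (PQ (w, w')); split => /=; first by case: (W0PQ _ Ww).
  by case: (W0PQ _ Ww').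
Qed.

Lemma open_diff W : open W -> open (add_set W (opp_set W)).
Proof.
move=> oW; have -> : add_set W (opp_set W) = \bigcup_(w in opp_set W) shift_set w W.
  apply/seteqP; split=> [_ [x Wx [w Ww <-]]|_ [w Ww [x Wx <-]]].
    by exists w => //; exists x => //; rewrite addrC.
  by exists x => //; exists w => //; rewrite addrC.
by apply: bigcup_open => w _; exact: open_shift.
Qed.

Lemma compact_sub_open K : compact K -> exists U, [/\ open U, K `<=` U & compact (closure U)].
Proof.
move=> cK; apply: (compact_property (P := fun B =>
  exists U, [/\ open U, B `<=` U & compact (closure U)]) _ _ _ _ cK).
- by exists set0; split => //; [exact: open0|rewrite closure0; exact: compact0].
- move=> B C [U [oU BU cU]] [V [oV CV cV]]; exists (U `|` V); split.
  + exact: openU.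
  + exact: setUSS.
  + by rewrite closureU; exact: compactU.
- by move=> B C BC [U [oU CU cU]]; exists U; split => //; exact: subset_trans CU.
- move=> x; have [W [oW Wx _ cW]] := locally_compact_nbhs lcG (@filterT _ (nbhs x) _).
  by exists W; [exact: open_nbhs_nbhs|exists W; split].
Qed.

Lemma norm_on_fin mu K : Radon_measure mu -> (norm_on K mu < +oo)%E ->
  norm_on K mu = (fine (norm_on K mu))%:E.
Proof.
by move=> muR Koo; rewrite fineK// ge0_fin_numE//; exact: norm_on_ge0.
Qed.

(** The indicator of a translate of K need not be lower semicontinuous; that of the translate of U
    is, and it is an admissible majorant in the upper integral. *)
Lemma norm_on_le mu K U (M : R) : open U -> K `<=` U ->
  (forall s g, Cc g -> (forall x, modulus (g x) <= \1_(shift_set s U) x) ->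
    modulus (mu g) <= M) ->
  (norm_on K mu <= M%:E)%E.
Proof.
move=> oU KU muM; apply: ge_ereal_sup => _ [s _ <-].
apply: (@le_trans _ _ (upper_integral_lsc mu (fun x => (\1_(shift_set s U) x)%:E))).
  apply: ereal_inf_lbound; exists (fun x => (\1_(shift_set s U) x)%:E) => //; split.
    by apply: lscr_indic; exact: open_shift.
  move=> x; rewrite !indic_shift lee_fin !indicE.
  by have [/set_mem/KU/mem_set->//|_] := boolP (x - s \in K); rewrite ler0n.
apply: upper_integral_lsc_le => g gc gU; rewrite lee_fin.
by apply: (muM s) => // x; rewrite -lee_fin.
Qed.

Variable haar : {measure set (borelType G) -> \bar R}.
Hypothesis haarP : is_Haar haar.

Lemma fine_haar_gt0 A : compact (closure A) -> open A -> (0 < haar A)%E ->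
  0 < fine (haar A).
Proof.
move=> cA oA A0; apply: fine_gt0; rewrite A0 /=.
apply: (haar_compact_lty haarP hausG cA); first exact: subset_closure.
exact: borel_open.
Qed.

(** c is absent from the bound: at stage n it is multiplied by the number of translates along the
    symmetric difference, divided by |A_n|, which tends to 0. *)
Lemma Eberlein_shift_le mu nu (An : nat -> set G) sigma K U W k0 (c c' : R) t s g :
  Radon_measure mu -> Radon_measure nu -> van_Hove haar An ->
  is_Eberlein_convolution haar An mu nu sigma ->
  open U -> (norm_on (closure U) nu < +oo)%E ->
  open W -> W 0 -> opp_set W `<=` W -> compact (closure W) ->
  shift_set k0 (add_set W (opp_set W)) `<=` K ->
  (norm_on K mu <= c%:E)%E ->
  (norm_on K (fun f => mu f - translate_measure t mu f)%R <= c'%:E)%E ->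
  0 <= c -> 0 <= c' ->
  Cc g -> (forall x, modulus (g x) <= \1_(shift_set s U) x) ->
  modulus (sigma g - translate_measure t sigma g) <=
    fine (norm_on (closure U) nu) * (c' / fine (haar W)).
Proof.
move=> muR nuR [oA cA A0 AvH] [_ sigmaP] oU Uoo oW W0 symW cW VK Kc Kc' c0 c'0 gc gU.
have cA' n : compact (closure (An n)) by rewrite -precompactE.
have oV := open_diff oW.
have hW0 : (0 < haar W)%E.
  by apply: (haar_gt0 haarP oW _ (oA 0) (cA' 0) (A0 0)); exists 0.
have w0 := fine_haar_gt0 cW oW hW0.
have a0 n := fine_haar_gt0 (cA' n) (oA n) (A0 n).
set b := fine (norm_on (closure U) nu); set w := fine (haar W) in w0 *.
pose a n := fine (haar (An n)).
pose K' := closure W `|` (shift_set t (closure W) `|` shift_set (- t) (closure W)).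
have cK' : compact K' by apply: compactU => //; apply: compactU; exact: compact_shift.
pose r1 n := fine (haar (van_Hove_boundary (closure W) (An n))) / a n.
pose r2 n := fine (haar (van_Hove_boundary K' (An n))) / a n.
have r10 : r1 @ \oo --> 0 by exact: AvH.
have r20 : r2 @ \oo --> 0 by exact: AvH.
have b0 : 0 <= b by apply: fine_ge0; exact: norm_on_ge0.
pose conv n f := (fine (haar (An n)))^-1%:Cx *
  convolution (restrict_measure mu (An n)) (restrict_measure nu (opp_set (An n))) f.
have gtC : Cc (translate_fun (- t) g) by exact: Cc_shift.
(* Vague convergence is needed at the two test functions g and g(. + t) only. *)
have cvg_g : conv n g - conv n (translate_fun (- t) g) @[n --> \oo] -->
    sigma g - translate_measure t sigma g.
  by apply: cvgB; exact: sigmaP.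
have oA' n : open (opp_set (An n)) by exact: open_opp.
have cA'' n : compact (closure (opp_set (An n))).
  apply: (compact_closure_sub hausG (compact_opp (cA' n))).
  by move=> _ [x Ax <-]; exists x => //; exact: subset_closure.
have g1 x : modulus (g x) <= 1.
  by apply: le_trans (gU x) _; rewrite indicE lern1 leq_b1.
have conv_le n : modulus (conv n g - conv n (translate_fun (- t) g)) <=
    b * ((1 + r1 n) / w * c' + r2 n / w * c).
  pose F x := restrict_measure nu (opp_set (An n)) (fun y => g (x + y)).
  have FC : Cc F by exact: Cc_slice g1.
  have Fb x : modulus (F x) <= b.
    exact: (slice_le hausG lcG _ nuR (oA' n) (cA'' n) (@subset_closure _ U)) gU.
  have [s1 s1w As1] := packing_set haarP hausG oW cW hW0 (oA n) (cA' n).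
  have [s2 s2w As2] := packing_symdiff haarP hausG t oW symW cW hW0 (oA n) (cA' n).
  have := restrict_shift_le hausG lcG muR (oA n) (cA' n) FC b0 Fb oV VK As1 As2 Kc Kc'.
  rewrite /conv -mulrBr modulusM modulus_real gtr0_norm ?invr_gt0//.
  (* Regrouping g(x + y + t) as g((x + t) + y) puts the translation on the outer variable, so nu
     enters through F alone. *)
  have -> : convolution (restrict_measure mu (An n))
      (restrict_measure nu (opp_set (An n))) (translate_fun (- t) g) =
      restrict_measure mu (An n) (fun x => F (x + t)).
    congr restrict_measure; apply/funext => x; congr restrict_measure.
    by apply/funext => y; rewrite /translate_fun opprK addrAC.
  move=> le_s; rewrite ler_pdivrMl//; apply: le_trans le_s _.
  rewrite mulrCA ler_wpM2l// mulrDr; apply: lerD.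
    rewrite mulrA ler_wpM2r// mulrA ler_pdivlMr// mulrDr mulr1 /r1 mulrC.
    by rewrite mulrCA divff ?gt_eqF// mulr1 mulrC.
  rewrite mulrA ler_wpM2r// mulrA ler_pdivlMr// /r2.
  by rewrite mulrCA divff ?gt_eqF// mulr1.
have cvgR : b * ((1 + r1 n) / w * c' + r2 n / w * c) @[n --> \oo] -->
    b * ((1 + 0) / w * c' + 0 / w * c).
  apply: cvgM; first exact: cvg_cst.
  apply: cvgD; (apply: cvgM; last exact: cvg_cst); apply: cvgM => //; try exact: cvg_cst.
  by apply: cvgD => //; exact: cvg_cst.
rewrite (_ : b * (c' / w) = b * ((1 + 0) / w * c' + 0 / w * c)); last first.
  by rewrite addr0 !mul0r addr0 mul1r [c' / w]mulrC.
apply: ler_cvg_to (cvg_modulus cvg_g) cvgR _.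
by apply: nearW => n; exact: conv_le.
Qed.

End Eberlein.

Theorem corollary4p31 (R : realType) (G : topologicalZmodType)
    (hausG : hausdorff_space G) (lcG : locally_compact [set: G])
    (scG : @second_countable G)
    (haar : {measure set (borelType G) -> \bar R}) (haarP : is_Haar haar)
    (mu nu : functional R G)
    (muR : Radon_measure mu) (nuR : Radon_measure nu)
    (mu_bd : translation_bounded mu) (nu_bd : translation_bounded nu)
    (A : nat -> set G) (A_vH : van_Hove haar A)
    (sigma : functional R G)
    (sigmaP : is_Eberlein_convolution haar A mu nu sigma)
    (K : set G) (Kcpt : compact K) (Kint : interior K !=set0) :
  norm_almost_periodic K mu -> norm_almost_periodic K sigma.
Proof.
move=> muK e e0.
have [W [oW W0 symW cW [k0 VK]]] := symmetric_nbhs lcG Kint.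
(* The test functions for the norm of sigma live on translates of U, so nu is measured on the
   closure of U, compact and with interior points. *)
have [U [oU KU cU]] := compact_sub_open lcG Kcpt.
have Uoo : (norm_on (closure U) nu < +oo)%E.
  apply: nu_bd => //; have [x Kx] := Kint; exists x.
  by move: Kx; apply: interiorS; apply: subset_trans KU _; exact: subset_closure.
have Koo : (norm_on K mu < +oo)%E by exact: mu_bd.
have w0 : 0 < fine (haar W).
  case: (A_vH) => oA cA A0 _; apply: fine_haar_gt0 => //.
  apply: (haar_gt0 haarP oW _ (oA 0) _ (A0 0)); first by exists 0.
  by rewrite -precompactE.
set b := fine (norm_on (closure U) nu); set w := fine (haar W) in w0.
have b1 : 0 < `|b| + 1 by rewrite ltr_wpDl.
(* A norm c' of mu - tau_t mu below this threshold gives b c' / w < e; the summand 1 keeps the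
   denominator positive when b = 0. *)
have d0 : 0 < e * w / (`|b| + 1) by rewrite divr_gt0// mulr_gt0.
have [C cC SC] := muK _ d0; exists C => //.
apply/seteqP; split => // x _.
have : setT x by [].
rewrite -SC; apply: add_subset => // t /= muKt.
have c'E := norm_on_fin (Radon_diff hausG t muR) (lt_trans muKt (ltry _)).
set c' := fine _ in c'E.
have cE := norm_on_fin muR Koo; set c := fine _ in cE.
have c0 : 0 <= c by apply: fine_ge0; exact: norm_on_ge0.
have c'0 : 0 <= c' by apply: fine_ge0; apply: norm_on_ge0; exact: Radon_diff.
apply: (@le_lt_trans _ _ (b * (c' / w))%:E).
  apply: (norm_on_le oU KU) => s g gc gU.
  apply: (Eberlein_shift_le hausG lcG haarP muR nuR A_vH sigmaP oU Uoo oW W0 symW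
    cW VK _ _ c0 c'0 gc gU); first by rewrite cE.
  by rewrite c'E.
move: muKt; rewrite c'E !lte_fin ltr_pdivlMr// mulrA ltr_pdivrMr//.
have := ler_norm b; nra.
Qed.
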